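(* Let $v,w$ be words over $\Sigma=\{1,\ldots,\sigma\}$ with $|v|=m\le|w|=n$ and $\sigma\le m$, let $N=mn$, and let $B\in[n]$. The problem LCS-BR of computing the largest $k\in\mathbb{N}$ such that there exists a common $B$-subsequence $s$ of $v$ and $w$ with $|s|=k$ can be solved in $O(NB^{o(1)})$ time.
   Context: $[n]=\{1,\ldots,n\}$. A word $s$ is a subsequence of $x$ if $s=x[i_1]x[i_2]\cdots x[i_k]$ for some $1\le i_1<\cdots<i_k\le|x|$. For an integer $B$, a word $s$ is a $B$-subsequence of a word $x$ if there exists a factor $x[i+1:i+B]=x[i+1]x[i+2]\cdots x[i+B]$ of $x$ (of length $B$) containing $s$ as a subsequence. A common $B$-subsequence of $v$ and $w$ is a word that is a $B$-subsequence of both $v$ and $w$. The computational model is the unit-cost RAM with logarithmic word size. *)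

(* Defs.v *)
From mathcomp Require Import all_boot all_order all_algebra.
From mathcomp Require Import all_classical all_reals all_analysis.

Set Implicit Arguments.
Unset Strict Implicit.
Unset Printing Implicit Defensive.

(** * Unit-cost RAM with bounded words

A machine has registers and a random-access memory, both holding [b]-bit
words, i.e. numbers below [2 ^ b].  Every instruction costs one time unit. *)

Inductive binop : Type :=
  | OpAdd | OpSub | OpMul | OpDiv | OpMod
  | OpAnd | OpOr | OpXor | OpShl | OpShr.

Inductive instr : Type :=
  | Const of nat & nat              (* [Const d x]: r_d := x               *)
  | Op of binop & nat & nat & nat   (* [Op o d i j]: r_d := r_i o r_j      *)
  | Read of nat & nat               (* [Read d i]: r_d := mem[r_i]         *)
  | Write of nat & nat              (* [Write i j]: mem[r_i] := r_j        *)
  | JumpEq of nat & nat & nat       (* [JumpEq i j l]: if r_i = r_j goto l *)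
  | JumpLt of nat & nat & nat       (* [JumpLt i j l]: if r_i < r_j goto l *)
  | Halt.

Definition program : Type := seq instr.

Record state : Type := State {
  pc : nat;
  reg : nat -> nat;
  mem : nat -> nat }.

Definition upd (f : nat -> nat) (i x : nat) : nat -> nat :=
  fun j => if j == i then x else f j.

(* Results wrap around modulo [2 ^ b]; [2 ^ b] is added in [OpSub] because
   subtraction on [nat] is truncated. *)
Definition eval_binop (b : nat) (o : binop) (x y : nat) : nat :=
  (match o with
   | OpAdd => x + y
   | OpSub => x + 2 ^ b - y
   | OpMul => x * y
   | OpDiv => x %/ y
   | OpMod => x %% y
   | OpAnd => Nat.land x y
   | OpOr => Nat.lor x y
   | OpXor => Nat.lxor x y
   | OpShl => x * 2 ^ y
   | OpShr => x %/ 2 ^ y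
   end) %% 2 ^ b.

(* Running past the end of the program halts. *)
Definition fetch (p : program) (s : state) : instr := nth Halt p (pc s).

Definition halted (p : program) (s : state) : bool :=
  if fetch p s is Halt then true else false.

(* A halted state is a fixed point, so [iter t (step b p) s] is halted exactly
   when the run from [s] halts after executing at most [t] instructions. *)
Definition step (b : nat) (p : program) (s : state) : state :=
  let: State l r h := s in
  match fetch p s with
  | Const d x => State l.+1 (upd r d (x %% 2 ^ b)) h
  | Op o d i j => State l.+1 (upd r d (eval_binop b o (r i) (r j))) h
  | Read d i => State l.+1 (upd r d (h (r i))) h
  | Write i j => State l.+1 r (upd h (r i) (r j))
  | JumpEq i j l' => State (if r i == r j then l' else l.+1) r h
  | JumpLt i j l' => State (if r i < r j then l' else l.+1) r h
  | Halt => s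
  end.

(* The number of bits of a word is [c] times the length of the binary
   expansion of the input size [k], where [c] is a constant of the machine. *)
Definition word_size (c k : nat) : nat := c * (trunc_log 2 k).+1.

(** * Longest common subsequence with bounded range *)

(* With 0-based sequences, the factor x[i+1:i+B] is [take B (drop i x)]; the
   bound on [i] makes it have length exactly [B]. *)
Definition B_subseq (B : nat) (s x : seq nat) : Prop :=
  exists2 i, i + B <= size x & subseq s (take B (drop i x)).

Definition common_B_subseq (B : nat) (v w s : seq nat) : Prop :=
  B_subseq B s v /\ B_subseq B s w.

Definition is_lcs_br (B : nat) (v w : seq nat) (k : nat) : Prop :=
  (exists2 s, common_B_subseq B v w s & size s = k) /\
  (forall s, common_B_subseq B v w s -> size s <= k).

(* The lengths |v|, |w| and the range [B] are in registers 0, 1, 2, the letters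
   of v followed by those of w are in memory cells 0, 1, ..., and all other
   registers and cells are 0. *)
Definition lcs_br_input (B : nat) (v w : seq nat) : state :=
  State 0 (nth 0 [:: size v; size w; B]) (nth 0 (v ++ w)).

Definition lcs_br_run (p : program) (c B : nat) (v w : seq nat) (t : nat) :
    state :=
  iter t (step (word_size c (size v + size w)) p) (lcs_br_input B v w).

Definition output (s : state) : nat := reg s 0.

(* Main.v *)
(* Cut v after every B-th row. A window of v starting at row i crosses exactly one
   cut r with i < r <= i + B, so the best alignment of v[i+1:i+B] with w[j+1:j+B]
   is the maximum over the columns k in [j, j + B] of
     f(k) = lcs(v[i+1:r], w[j+1:k]) + lcs(v[r+1:i+B], w[k+1:j+B]).
   For a fixed first word, the increment of lcs(x, y[j:k]) in k is 1 exactly when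
   j is at least a threshold depending on k only, and "combing" computes these
   thresholds row by row in constant time per cell; this gives both summands for
   all the O(B) rows around a cut in O(nB) time (the first one in the reversed
   words). Inverting the threshold arrays also gives the increments in j, so f can
   be updated in constant time whenever j or k moves by one. Since alignment paths
   can be uncrossed, the leftmost maximiser k(i, j) satisfies
     k(i, j - 1) <= k(i, j) <= k(i - 1, j),
   and, as in Knuth's optimal search trees, the lengths of these search ranges
   telescope to O(nB) per cut. Hence the running time is O(mn), and eps = 0. *)
Require Import Defs.
From mathcomp Require Import all_boot all_order all_algebra.
From mathcomp Require Import all_classical all_reals all_analysis.
From mathcomp Require Import zify.

Set Implicit Arguments.
Unset Strict Implicit.
Unset Printing Implicit Defensive.

(** * A structured language over the RAM *)

(** Thresholds also replace the uncrossing of paths. Between neighbouring windows f changes by a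
    difference of two 0/1 step functions of k, one increasing and the other decreasing; the change
    is therefore monotone in k, and this single-crossing property orders the leftmost maximisers.
    Windows that cross one cut share the last row of their upper part and vary its first row,
    whereas combing extends a word at its end; hence the reversal. A step of k moves the start of a
    factor in both summands and reads the inverse arrays; a step of j moves the end and reads the
    thresholds. The other obstacle is the machine, where results wrap modulo a power of 2 and time
    is an instruction count. The program is therefore written in a small structured language whose
    semantics counts the instructions of the compiled code and whose [safe] conditions exclude
    overflow, so that its verification is ordinary arithmetic on [nat]. *)

Inductive exp : Type :=
  | Var of nat
  | Lit of nat
  | Bin of binop & exp & exp
  | Get of nat & exp
  | Inp of exp.

Inductive cmd : Type :=
  | Skip
  | Asg of nat & exp
  | Put of nat & exp & exp
  | Seq of cmd & cmd
  | IfEq of exp & exp & cmd & cmd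
  | IfLt of exp & exp & cmd & cmd
  | For of nat & exp & cmd.

Record store : Type := Store { var : nat -> nat; arr : nat -> nat -> nat }.

Definition set_var (s : store) (d x : nat) : store :=
  Store (upd (var s) d x) (arr s).

Definition set_arr (s : store) (q i x : nat) : store :=
  Store (var s) (fun q' => if q' == q then upd (arr s q) i x else arr s q').

(** The operations mapped to 0 are exactly those that [op_safe] rejects. *)
Definition eval_op (o : binop) (x y : nat) : nat :=
  match o with
  | OpAdd => x + y | OpSub => x - y | OpMul => x * y | OpDiv => x %/ y
  | _ => 0
  end.

(* Variables below [base_reg] live in the registers of the same number, the
   registers above it hold temporaries, and cell [i] of array [q] is the memory
   cell [M + (8 * i + q)], where [M] is the content of [base_reg]. *)
Local Notation base_reg := 31.
Local Notation tmp := 32.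

Definition reg_of (e : exp) (d : nat) : nat := if e is Var i then i else d.

(** Interleaving with stride 8 makes an address depend on the run-time base alone, and on no array
    length. *)
Definition addr_code (q d i : nat) : program :=
  [:: Const d.+1 8; Op OpMul d i d.+1; Const d.+1 q; Op OpAdd d d d.+1;
      Op OpAdd d d base_reg].

(** Registers from [d] upwards serve as a stack, so the left operand survives while the right one is
    computed from [d.+1]. A variable needs no code: it is read in its own register. *)
Fixpoint exp_code (e : exp) (d : nat) : program :=
  match e with
  | Var _ => [::]
  | Lit x => [:: Const d x]
  | Bin o e1 e2 =>
    exp_code e1 d ++ exp_code e2 d.+1 ++
    [:: Op o d (reg_of e1 d) (reg_of e2 d.+1)]
  | Get q e1 => exp_code e1 d ++ addr_code q d (reg_of e1 d) ++ [:: Read d d]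
  | Inp e1 => exp_code e1 d ++ [:: Read d (reg_of e1 d)]
  end.

Definition test_code (e1 e2 : exp) : program :=
  exp_code e1 tmp ++ exp_code e2 tmp.+1.

(* [JumpEq 0 0] is the unconditional jump. *)
Fixpoint cmd_code (c : cmd) (l : nat) : program :=
  match c with
  | Skip => [::]
  | Asg d e =>
    exp_code e tmp ++ [:: Const tmp.+1 0; Op OpAdd d (reg_of e tmp) tmp.+1]
  | Put q e1 e2 =>
    exp_code e1 tmp ++ addr_code q tmp (reg_of e1 tmp) ++
    exp_code e2 tmp.+1 ++ [:: Write tmp (reg_of e2 tmp.+1)]
  | Seq c1 c2 =>
    let p1 := cmd_code c1 l in p1 ++ cmd_code c2 (l + size p1)
  | IfEq e1 e2 c1 c2 =>
    let p0 := test_code e1 e2 in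
    let l2 := (l + size p0).+1 in
    let p2 := cmd_code c2 l2 in
    let l1 := (l2 + size p2).+1 in
    let p1 := cmd_code c1 l1 in
    p0 ++ [:: JumpEq (reg_of e1 tmp) (reg_of e2 tmp.+1) l1] ++
    p2 ++ [:: JumpEq 0 0 (l1 + size p1)] ++ p1
  | IfLt e1 e2 c1 c2 =>
    let p0 := test_code e1 e2 in
    let l2 := (l + size p0).+1 in
    let p2 := cmd_code c2 l2 in
    let l1 := (l2 + size p2).+1 in
    let p1 := cmd_code c1 l1 in
    p0 ++ [:: JumpLt (reg_of e1 tmp) (reg_of e2 tmp.+1) l1] ++
    p2 ++ [:: JumpEq 0 0 (l1 + size p1)] ++ p1
  | For x e c1 =>
    let p0 := exp_code e tmp in
    let l1 := (l + size p0).+2 in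
    let p1 := cmd_code c1 l1 in
    p0 ++ [:: JumpLt x (reg_of e tmp) l1; JumpEq 0 0 (l1 + size p1).+3] ++
    p1 ++ [:: Const tmp 1; Op OpAdd x x tmp; JumpEq 0 0 l]
  end.

(** * Big-step semantics with exact instruction counts *)

Section Semantics.

Variables (b M X : nat) (inp : nat -> nat).
Local Notation W := (2 ^ b).

Fixpoint eval (s : store) (e : exp) : nat :=
  match e with
  | Var i => var s i
  | Lit x => x
  | Bin o e1 e2 => eval_op o (eval s e1) (eval s e2)
  | Get q e1 => arr s q (eval s e1)
  | Inp e1 => inp (eval s e1)
  end.

(** Ranges in which the wrapped machine result agrees with [eval_op]; for [OpSub] they exclude
    truncation and wrap-around at once. *)
Definition op_safe (o : binop) (x y : nat) : Prop :=
  match o with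
  | OpAdd => x + y < W
  | OpSub => y <= x < W
  | OpMul => x * y < W
  | OpDiv => x < W
  | _ => False
  end.

Fixpoint safe (s : store) (e : exp) : Prop :=
  match e with
  | Var i => i < base_reg
  | Lit x => x < W
  | Bin o e1 e2 =>
    [/\ safe s e1, safe s e2 & op_safe o (eval s e1) (eval s e2)]
  | Get q e1 => [/\ safe s e1, q < 8 & eval s e1 < X]
  | Inp e1 => safe s e1 /\ eval s e1 < M
  end.

(** The counts mirror the compiled code: an assignment copies by adding 0, which takes 2
    instructions and reduces modulo W; an address takes 5; a failed test pays one more jump, over
    the other branch; closing a loop iteration takes 3. *)
Inductive exec : cmd -> store -> nat -> store -> Prop :=
  | ExecSkip s : exec Skip s 0 s
  | ExecAsg s d e :
      d < base_reg -> safe s e -> eval s e < W ->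
      exec (Asg d e) s (size (exp_code e tmp) + 2) (set_var s d (eval s e))
  | ExecPut s q e1 e2 :
      q < 8 -> safe s e1 -> safe s e2 -> eval s e1 < X ->
      exec (Put q e1 e2) s
        (size (exp_code e1 tmp) + 5 + size (exp_code e2 tmp.+1) + 1)
        (set_arr s q (eval s e1) (eval s e2))
  | ExecSeq s1 s2 s3 c1 c2 t1 t2 :
      exec c1 s1 t1 s2 -> exec c2 s2 t2 s3 ->
      exec (Seq c1 c2) s1 (t1 + t2) s3
  | ExecIfEqT s1 s2 e1 e2 c1 c2 t :
      safe s1 e1 -> safe s1 e2 -> eval s1 e1 == eval s1 e2 ->
      exec c1 s1 t s2 ->
      exec (IfEq e1 e2 c1 c2) s1 (size (test_code e1 e2) + 1 + t) s2
  | ExecIfEqF s1 s2 e1 e2 c1 c2 t :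
      safe s1 e1 -> safe s1 e2 -> eval s1 e1 != eval s1 e2 ->
      exec c2 s1 t s2 ->
      exec (IfEq e1 e2 c1 c2) s1 (size (test_code e1 e2) + 1 + t + 1) s2
  | ExecIfLtT s1 s2 e1 e2 c1 c2 t :
      safe s1 e1 -> safe s1 e2 -> eval s1 e1 < eval s1 e2 ->
      exec c1 s1 t s2 ->
      exec (IfLt e1 e2 c1 c2) s1 (size (test_code e1 e2) + 1 + t) s2
  | ExecIfLtF s1 s2 e1 e2 c1 c2 t :
      safe s1 e1 -> safe s1 e2 -> eval s1 e2 <= eval s1 e1 ->
      exec c2 s1 t s2 ->
      exec (IfLt e1 e2 c1 c2) s1 (size (test_code e1 e2) + 1 + t + 1) s2
  | ExecForDone s x e c :
      x < base_reg -> safe s e -> eval s e <= var s x ->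
      exec (For x e c) s (size (exp_code e tmp) + 2) s
  | ExecForStep s1 s2 s3 x e c t1 t2 :
      x < base_reg -> safe s1 e -> var s1 x < eval s1 e ->
      exec c s1 t1 s2 -> (var s2 x).+1 < W ->
      exec (For x e c) (set_var s2 x (var s2 x).+1) t2 s3 ->
      exec (For x e c) s1 (size (exp_code e tmp) + 1 + t1 + 3 + t2) s3.

Lemma eval_binop_safe o x y : op_safe o x y -> eval_binop b o x y = eval_op o x y.
Proof.
rewrite /eval_binop; case: o => //= h; try exact: modn_small.
  have -> : x + W - y = (x - y) + W by lia.
  by rewrite modnDr modn_small //; lia.
by apply: modn_small; exact: leq_ltn_trans (leq_div _ _) h.
Qed.

(** * Correctness of the compiler *)

Section Compiler.

Hypothesis X_lt : M + 8 * X + 8 < W.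

Definition code_at (p : program) (l : nat) (q : program) : Prop :=
  forall k, k < size q -> nth Halt p (l + k) = nth Halt q k.

Lemma code_at_cat p l q1 q2 :
  code_at p l (q1 ++ q2) -> code_at p l q1 /\ code_at p (l + size q1) q2.
Proof.
move=> H; split=> k hk.
  by rewrite H ?size_cat ?ltn_addr // nth_cat hk.
by rewrite -addnA H ?size_cat ?ltn_add2l // nth_cat ltnNge leq_addr addKn.
Qed.

Lemma code_at_cons p l i q :
  code_at p l (i :: q) -> nth Halt p l = i /\ code_at p l.+1 q.
Proof.
move=> H; split=> [|k hk]; first by rewrite -{1}[l]addn0 H.
by rewrite addSnnS H.
Qed.

Definition agree (s : store) (r h : nat -> nat) : Prop :=
  [/\ forall i, i < base_reg -> r i = var s i,
      r base_reg = M,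
      forall x, x < M -> h x = inp x &
      forall q x, q < 8 -> x < X -> h (M + (8 * x + q)) = arr s q x].

#[local] Arguments step : simpl never.
#[local] Arguments addr_code : simpl never.

Lemma step_instr p l r h i :
  nth Halt p l = i ->
  step b p (State l r h) =
  match i with
  | Const d x => State l.+1 (upd r d (x %% W)) h
  | Op o d i j => State l.+1 (upd r d (eval_binop b o (r i) (r j))) h
  | Read d i => State l.+1 (upd r d (h (r i))) h
  | Write i j => State l.+1 r (upd h (r i) (r j))
  | JumpEq i j l' => State (if r i == r j then l' else l.+1) r h
  | JumpLt i j l' => State (if r i < r j then l' else l.+1) r h
  | Halt => State l r h
  end.
Proof. by move=> E; rewrite /step /fetch /= E. Qed.

Lemma upd_eq f i x : upd f i x i = x.
Proof. by rewrite /upd eqxx. Qed.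

Lemma upd_neq f i x j : j != i -> upd f i x j = f j.
Proof. by rewrite /upd => /negPf->. Qed.

(** The bound [i <= d] keeps the index register apart from the scratch register [d.+1], which is
    overwritten first; [X_lt] keeps all intermediate results below W. *)
Lemma addr_code_run p l q d i r h :
  base_reg < d -> i <= d -> code_at p l (addr_code q d i) -> q < 8 ->
  r i < X -> r base_reg = M ->
  exists r', [/\ iter 5 (step b p) (State l r h) = State (l + 5) r' h,
    forall j, j < d -> r' j = r j & r' d = M + (8 * r i + q)].
Proof.
move=> hd hi + hq hri hM.
have h1 : op_safe OpMul (r i) 8 by rewrite /=; lia.
have h2 : op_safe OpAdd (r i * 8) q by rewrite /=; lia.
have h3 : op_safe OpAdd (r i * 8 + q) M by rewrite /=; lia.
case/code_at_cons=> e1 /code_at_cons[e2] /code_at_cons[e3] /code_at_cons[e4]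
  /code_at_cons[e5] _.
rewrite /= (step_instr _ _ e1) (step_instr _ _ e2) (step_instr _ _ e3)
  (step_instr _ _ e4) (step_instr _ _ e5).
eexists; split; first by rewrite addnC.
  by move=> j hj; rewrite !upd_neq //; lia.
have dS : d.+1 != d by lia.
have dS' : d != d.+1 by lia.
rewrite !(upd_eq, upd_neq _ _ dS, upd_neq _ _ dS').
rewrite !upd_neq ?hM; try lia.
rewrite [8 %% W]modn_small; last by lia.
rewrite [q %% W]modn_small; last by lia.
by rewrite (eval_binop_safe h1) (eval_binop_safe h2) (eval_binop_safe h3) /=
  [8 * _]mulnC addnC.
Qed.

Lemma reg_of_le s e d : safe s e -> base_reg < d -> reg_of e d <= d.
Proof. by case: e => //= i hi; lia. Qed.

Lemma iter_add_step p t1 t2 x : 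
  iter (t1 + t2) (step b p) x = iter t2 (step b p) (iter t1 (step b p) x).
Proof. by rewrite addnC iterD. Qed.

Lemma agree_var s r h x : agree s r h -> x < base_reg -> r x = var s x.
Proof. by case=> H _ _ _ /H. Qed.

Lemma agree_regs s r r' h :
  agree s r h -> (forall j, j <= base_reg -> r' j = r j) -> agree s r' h.
Proof.
case=> A1 A2 A3 A4 H; split=> // [i hi|]; last by rewrite H.
by rewrite H ?A1 // ltnW.
Qed.

Lemma exp_code_run p l e d s r h :
  base_reg < d -> agree s r h -> safe s e -> code_at p l (exp_code e d) ->
  exists r', [/\ iter (size (exp_code e d)) (step b p) (State l r h) =
                 State (l + size (exp_code e d)) r' h,
    forall j, j < d -> r' j = r j & r' (reg_of e d) = eval s e].
Proof.
elim: e l d r => [i|x|o e1 IH1 e2 IH2|q e1 IH1|e1 IH1] l d r hd A.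
- by move=> hi _; exists r; rewrite addn0; case: A => A *; split; rewrite //= A.
- move=> /= hx /code_at_cons[e1 _].
  rewrite (step_instr _ _ e1); eexists; split; first by rewrite addn1.
    by move=> j hj; rewrite upd_neq //; lia.
  by rewrite upd_eq modn_small.
- move=> /= [s1 s2 so] /code_at_cat[c1] /code_at_cat[c2] /code_at_cons[e _].
  have [r1 [E1 F1 V1]] := IH1 _ _ _ hd A s1 c1.
  have A1 : agree s r1 h.
    by apply: (agree_regs A) => j hj; apply: F1; exact: leq_ltn_trans hj hd.
  have [|r2 [E2 F2 V2]] := IH2 _ d.+1 r1 _ A1 s2 c2; first by lia.
  rewrite !size_cat !iter_add_step E1 E2 /= (step_instr _ _ e).
  eexists; split; first by rewrite !addnA addn1.
    by move=> j hj; rewrite upd_neq ?F2 ?F1 //; lia.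
  rewrite upd_eq V2 F2 ?V1 ?eval_binop_safe //.
  by have := reg_of_le s1 hd; lia.
- have -> : exp_code (Get q e1) d =
      exp_code e1 d ++ addr_code q d (reg_of e1 d) ++ [:: Read d d] by [].
  move=> [s1 hq hX] /code_at_cat[c1] /code_at_cat[c2] /code_at_cons[e _].
  have [r1 [E1 F1 V1]] := IH1 _ _ _ hd A s1 c1.
  case: A => A1 A2 A3 A4.
  have [||r2 [E2 F2 V2]] :=
    @addr_code_run p _ q d (reg_of e1 d) r1 h hd (reg_of_le s1 hd) c2 hq.
  + by rewrite V1.
  + by rewrite F1.
  rewrite !size_cat !iter_add_step E1 (E2 : iter (size (addr_code _ _ _)) _ _ = _)
    /= (step_instr _ _ e).
  eexists; split; first by rewrite !addnA addn1.
    by move=> j hj; rewrite upd_neq ?F2 ?F1 //; lia.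
  by rewrite upd_eq V2 V1 A4.
- move=> /= [s1 hM] /code_at_cat[c1] /code_at_cons[e _].
  have [r1 [E1 F1 V1]] := IH1 _ _ _ hd A s1 c1.
  rewrite size_cat iter_add_step E1 /= (step_instr _ _ e).
  eexists; split; first by rewrite addnA addn1.
    by move=> j hj; rewrite upd_neq ?F1 //; lia.
  by rewrite upd_eq V1; case: A => _ _ ->.
Qed.

Lemma test_code_run p l e1 e2 s r h :
  agree s r h -> safe s e1 -> safe s e2 -> code_at p l (test_code e1 e2) ->
  exists r', [/\ iter (size (test_code e1 e2)) (step b p) (State l r h) =
                 State (l + size (test_code e1 e2)) r' h,
    agree s r' h, r' (reg_of e1 tmp) = eval s e1 &
    r' (reg_of e2 tmp.+1) = eval s e2].
Proof.
move=> A s1 s2 /code_at_cat[c1 c2].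
have [//|r1 [E1 F1 V1]] := exp_code_run _ A s1 c1.
have A1 : agree s r1 h by apply: (agree_regs A) => j hj; apply: F1.
have [//|r2 [E2 F2 V2]] := exp_code_run _ A1 s2 c2.
exists r2; split=> //.
- by rewrite size_cat iter_add_step E1 E2 addnA.
- by apply: (agree_regs A1) => j hj; apply: F2; rewrite ltnW.
by rewrite F2 // ltnS (reg_of_le s1).
Qed.

Lemma size_if_code l p0 (i : instr) p2 (j : instr) p1 :
  l + size (p0 ++ [:: i] ++ p2 ++ [:: j] ++ p1) =
  ((l + size p0).+1 + size p2).+1 + size p1.
Proof. by rewrite !size_cat /=; lia. Qed.

Lemma size_for_code l p0 (i j : instr) p1 (i1 i2 i3 : instr) :
  l + size (p0 ++ [:: i; j] ++ p1 ++ [:: i1; i2; i3]) =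
  ((l + size p0).+2 + size p1).+3.
Proof. by rewrite !size_cat /=; lia. Qed.

(** Induction on the execution rather than on the command: the last premise of a loop step is an
    execution of the same loop, run by the same code at the same position. *)
Lemma cmd_code_run p c s t s' l r h :
  exec c s t s' -> agree s r h -> code_at p l (cmd_code c l) ->
  exists r' h', iter t (step b p) (State l r h) =
    State (l + size (cmd_code c l)) r' h' /\ agree s' r' h'.
Proof.
move=> E; elim: E l r h => {c s t s'}.
- by move=> s l r h A _; exists r, h; rewrite addn0.
- move=> s d e hd se ve l r h A /code_at_cat[c1] /code_at_cons[e1]
    /code_at_cons[e2] _.
  have [//|r1 [E1 F1 V1]] := exp_code_run _ A se c1.
  rewrite iter_add_step E1 /= (step_instr _ _ e1) (step_instr _ _ e2).
  have hle := @reg_of_le _ _ tmp se isT.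
  rewrite upd_eq upd_neq ?V1; last by lia.
  rewrite mod0n (@eval_binop_safe OpAdd) /=; last by rewrite addn0.
  do 2!eexists; split; first by rewrite size_cat addnA addn2.
  case: A => A1 A2 A3 A4; split=> //= [i hi|].
    rewrite addn0 /upd; case: ifP => // _.
    by rewrite ifF ?F1 ?A1 //; lia.
  by rewrite !upd_neq ?F1 //; lia.
- move=> s q e1 e2 hq s1 s2 hX l r h A /code_at_cat[c1]
    /(@code_at_cat _ _ (addr_code _ _ _))[c2] /code_at_cat[c3] /code_at_cons[e _].
  have [//|r1 [E1 F1 V1]] := exp_code_run _ A s1 c1.
  have A1 : agree s r1 h by apply: (agree_regs A) => j hj; apply: F1.
  have [||r2 [E2 F2 V2]] :=
    @addr_code_run p _ q tmp (reg_of e1 tmp) r1 h isT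
      (@reg_of_le _ _ tmp s1 isT) c2 hq.
  + by rewrite V1.
  + by case: A1.
  have A2 : agree s r2 h by apply: (agree_regs A1) => j hj; apply: F2.
  have [//|r3 [E3 F3 V3]] := exp_code_run _ A2 s2 c3.
  rewrite !iter_add_step E1 E2 E3 [iter 1 _ _]/= (step_instr _ _ e) V3 (F3 tmp) //
    V2 V1.
  have -> : size (cmd_code (Put q e1 e2) l) =
      size (exp_code e1 tmp) + 5 + size (exp_code e2 tmp.+1) + 1.
    by rewrite /= !size_cat /= size_cat /=; lia.
  do 2!eexists; split; first by rewrite !addnA addn1.
  have {A1 A2} := agree_regs A2 (fun j hj => F3 j (leqW hj)).
  case=> A1 A2 A3 A4; split=> //= [x hx|q' x hq' hx].
    by rewrite upd_neq ?A3 //; lia.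
  (* Array numbers are below 8, so by division with remainder two cells share an address only if
     array and index both agree. *)
  case: (altP (q' =P q)) => [->|nq]; last by rewrite upd_neq ?A4 //; lia.
  rewrite /upd; case: (altP (x =P _)) => [->|nx].
    by case: eqP => // neq; case: neq; lia.
  by rewrite ifF ?A4 //; lia.
- move=> s1 s2 s3 c1 c2 t1 t2 _ IH1 _ IH2 l r h A /code_at_cat[k1 k2].
  have [r1 [h1 [E1 A1]]] := IH1 _ _ _ A k1.
  have [r2 [h2 [E2 A2]]] := IH2 _ _ _ A1 k2.
  by exists r2, h2; rewrite iter_add_step E1 E2 size_cat addnA.
- move=> s1 s2 e1 e2 c1 c2 t se1 se2 hb _ IH l r h A /code_at_cat[k0]
    /code_at_cons[e] /code_at_cat[_] /code_at_cons[_ k1].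
  have [r1 [E1 A1 V1 V2]] := test_code_run A se1 se2 k0.
  rewrite !iter_add_step E1 [iter 1 _ _]/= (step_instr _ _ e) V1 V2 hb.
  have [r2 [h2 [E2 A2]]] := IH _ _ _ A1 k1; exists r2, h2; split=> //.
  by rewrite E2; congr State; exact/esym/size_if_code.
- move=> s1 s2 e1 e2 c1 c2 t se1 se2 hb _ IH l r h A /code_at_cat[k0]
    /code_at_cons[e] /code_at_cat[k2] /code_at_cons[e' _].
  have [r1 [E1 A1 V1 V2]] := test_code_run A se1 se2 k0.
  rewrite !iter_add_step E1 [iter 1 _ _]/= (step_instr _ _ e) V1 V2 (negPf hb).
  have [r2 [h2 [E2 A2]]] := IH _ _ _ A1 k2; exists r2, h2; split=> //.
  rewrite E2 (step_instr _ _ e') eqxx.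
  by congr State; exact/esym/size_if_code.
- move=> s1 s2 e1 e2 c1 c2 t se1 se2 hb _ IH l r h A /code_at_cat[k0]
    /code_at_cons[e] /code_at_cat[_] /code_at_cons[_ k1].
  have [r1 [E1 A1 V1 V2]] := test_code_run A se1 se2 k0.
  rewrite !iter_add_step E1 [iter 1 _ _]/= (step_instr _ _ e) V1 V2 hb.
  have [r2 [h2 [E2 A2]]] := IH _ _ _ A1 k1; exists r2, h2; split=> //.
  by rewrite E2; congr State; exact/esym/size_if_code.
- move=> s1 s2 e1 e2 c1 c2 t se1 se2 hb _ IH l r h A /code_at_cat[k0]
    /code_at_cons[e] /code_at_cat[k2] /code_at_cons[e' _].
  have [r1 [E1 A1 V1 V2]] := test_code_run A se1 se2 k0.
  rewrite !iter_add_step E1 [iter 1 _ _]/= (step_instr _ _ e) V1 V2 ltnNge hb /=.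
  have [r2 [h2 [E2 A2]]] := IH _ _ _ A1 k2; exists r2, h2; split=> //.
  rewrite E2 (step_instr _ _ e') eqxx.
  by congr State; exact/esym/size_if_code.
- move=> s x e c hx se hv l r h A /code_at_cat[k0] /code_at_cons[i1]
    /code_at_cons[i2] _.
  have [//|r1 [E1 F1 V1]] := exp_code_run _ A se k0.
  have A1 : agree s r1 h by apply: (agree_regs A) => j hj; apply: F1.
  rewrite iter_add_step E1 [iter 2 _ _]/= (step_instr _ _ i1) V1.
  rewrite (agree_var A1 hx).
  rewrite ltnNge hv [~~ true]/= (step_instr _ _ i2) eqxx; exists r1, h; split=> //.
  by congr State; exact/esym/size_for_code.
move=> s1 s2 s3 x e c t1 t2 hx se hv _ IH1 hW _ IH2 l r h A k.
case/code_at_cat: (k) => k0 /code_at_cons[i1] /code_at_cons[_] /code_at_cat[k1]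
  /code_at_cons[i2] /code_at_cons[i3] /code_at_cons[i4] _.
have [//|r1 [E1 F1 V1]] := exp_code_run _ A se k0.
have A1 : agree s1 r1 h by apply: (agree_regs A) => j hj; apply: F1.
have e1 := agree_var A1 hx.
rewrite !iter_add_step E1 [iter 1 _ _]/= (step_instr _ _ i1) V1 e1 hv.
have [r2 [h2 [E2 A2]]] := IH1 _ _ _ A1 k1; rewrite E2 [iter 3 _ _]/=
  (step_instr _ _ i2)
  (step_instr _ _ i3) (step_instr _ _ i4) eqxx.
have e2 := agree_var A2 hx.
apply: IH2 => //; case: A2 => B1 B2 B3 B4; split=> //= [i hi|].
  rewrite /upd; case: (i =P x) => [_|_]; last by rewrite ifF ?B1 //; lia.
  rewrite ifF ?eqxx ?e2; last by lia.
  by rewrite modn_small ?(@eval_binop_safe OpAdd) /= ?addn1 //; lia.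
by rewrite !upd_neq //; lia.
Qed.

(** The prefixed addition puts |v| + |w|, the first cell behind the input, into [base_reg]. *)
Definition compile (c : cmd) : program := Op OpAdd base_reg 0 1 :: cmd_code c 1.

Lemma compile_run c t s s' h :
  exec c s t s' -> var s 0 + var s 1 = M -> (forall x, x < M -> h x = inp x) ->
  (forall q x, q < 8 -> x < X -> h (M + (8 * x + q)) = arr s q x) ->
  exists r' h', [/\ iter t.+1 (step b (compile c)) (State 0 (var s) h) =
                      State (size (compile c)) r' h' &
                    forall i, i < base_reg -> r' i = var s' i].
Proof.
move=> E eM eh ea.
have A : agree s (upd (var s) base_reg (eval_binop b OpAdd (var s 0) (var s 1))) h.
  split=> // [i hi|]; first by rewrite upd_neq //; lia.
  by rewrite upd_eq (@eval_binop_safe OpAdd) //=; lia.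
have C : code_at (compile c) 1 (cmd_code c 1) by [].
have [r' [h' [Et [A' _ _ _]]]] := cmd_code_run E A C.
by exists r', h'; split=> //; rewrite iterSr -Et.
Qed.

Lemma compile_halted c r h : halted (compile c) (State (size (compile c)) r h).
Proof. by rewrite /halted /fetch nth_default. Qed.

End Compiler.

(** * Total correctness with time bounds *)

Fixpoint written_vars (c : cmd) : seq nat :=
  match c with
  | Skip | Put _ _ _ => [::]
  | Asg d _ => [:: d]
  | Seq c1 c2 | IfEq _ _ c1 c2 | IfLt _ _ c1 c2 =>
    written_vars c1 ++ written_vars c2
  | For x _ c1 => x :: written_vars c1
  end.

Fixpoint written_arrs (c : cmd) : seq nat :=
  match c with
  | Skip | Asg _ _ => [::]
  | Put q _ _ => [:: q]
  | Seq c1 c2 | IfEq _ _ c1 c2 | IfLt _ _ c1 c2 =>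
    written_arrs c1 ++ written_arrs c2
  | For _ _ c1 => written_arrs c1
  end.

Definition same_off (vs qs : seq nat) (s s' : store) : Prop :=
  (forall i, i \notin vs -> var s' i = var s i) /\
  (forall q, q \notin qs -> arr s' q = arr s q).

Definition framed (c : cmd) : store -> store -> Prop :=
  same_off (written_vars c) (written_arrs c).

Lemma same_off_trans vs qs s1 s2 s3 :
  same_off vs qs s1 s2 -> same_off vs qs s2 s3 -> same_off vs qs s1 s3.
Proof.
move=> [v1 a1] [v2 a2]; split=> i hi; first by rewrite v2 ?v1.
by rewrite a2 ?a1.
Qed.

Lemma same_off_sub vs qs vs' qs' s1 s2 :
  {subset vs <= vs'} -> {subset qs <= qs'} ->
  same_off vs qs s1 s2 -> same_off vs' qs' s1 s2.
Proof.
move=> hv hq [v a]; split=> i hi; first by apply/v; apply: contra hi => /hv.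
by apply/a; apply: contra hi => /hq.
Qed.

Lemma exec_framed c s t s' : exec c s t s' -> framed c s s'.
Proof.
have subl (a b' : seq nat) : {subset a <= a ++ b'}.
  by move=> i; rewrite mem_cat => ->.
have subr (a b' : seq nat) : {subset b' <= a ++ b'}.
  by move=> i; rewrite mem_cat orbC => ->.
elim=> {c s t s'} //=.
- by move=> s d e _ _ _; split=> //= i; rewrite inE => /upd_neq->.
- by move=> s q e1 e2 _ _ _ _; split=> //= i; rewrite inE => /negPf->.
- move=> s1 s2 s3 c1 c2 t1 t2 _ F1 _ F2.
  apply: same_off_trans (same_off_sub _ _ F1) (same_off_sub _ _ F2);
    by [apply: subl | apply: subr].
- by move=> s1 s2 e1 e2 c1 c2 t _ _ _ _; apply: same_off_sub; apply: subl.
- by move=> s1 s2 e1 e2 c1 c2 t _ _ _ _; apply: same_off_sub; apply: subr.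
- by move=> s1 s2 e1 e2 c1 c2 t _ _ _ _; apply: same_off_sub; apply: subl.
- by move=> s1 s2 e1 e2 c1 c2 t _ _ _ _; apply: same_off_sub; apply: subr.
move=> s1 s2 s3 x e c t1 t2 _ _ _ _ F1 _ _ F2; apply: same_off_trans F2.
apply: (@same_off_trans _ _ _ s2).
  by apply: same_off_sub F1 => // i hi; rewrite inE hi orbT.
by split=> //= i; rewrite inE negb_or => /andP[/upd_neq-> _].
Qed.

Definition run (c : cmd) (s : store) (T : nat) (Q : store -> Prop) : Prop :=
  exists t s', [/\ exec c s t s', t <= T & Q s'].

(** The frame comes for free from the execution, so specifications need not list what a command
    leaves unchanged. *)
Lemma run_weaken c s T T' (Q Q' : store -> Prop) :
  run c s T Q -> T <= T' -> (forall s', framed c s s' -> Q s' -> Q' s') ->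
  run c s T' Q'.
Proof.
case=> t [s' [E ht HQ]] hT H; exists t, s'.
by split; [|exact: leq_trans hT | apply: H; first exact: exec_framed E].
Qed.

Lemma run_seq c1 c2 s T1 T2 (Q : store -> Prop) :
  run c1 s T1 (fun s' => run c2 s' T2 Q) -> run (Seq c1 c2) s (T1 + T2) Q.
Proof.
case=> t1 [s1 [E1 h1 [t2 [s2 [E2 h2 HQ]]]]]; exists (t1 + t2), s2.
by split; [exact: ExecSeq E1 E2 | exact: leq_add |].
Qed.

Lemma run_ifLt e1 e2 c1 c2 s T (Q : store -> Prop) :
  safe s e1 -> safe s e2 ->
  (eval s e1 < eval s e2 -> run c1 s T Q) ->
  (eval s e2 <= eval s e1 -> run c2 s T Q) ->
  run (IfLt e1 e2 c1 c2) s (size (test_code e1 e2) + 2 + T) Q.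
Proof.
move=> s1 s2 H1 H2; case: (ltnP (eval s e1) (eval s e2)) => h.
  case: (H1 h) => t [s' [E ht HQ]].
  by do 2!eexists; split; [exact: ExecIfLtT E | lia |].
case: (H2 h) => t [s' [E ht HQ]].
by do 2!eexists; split; [exact: ExecIfLtF E | lia |].
Qed.

Lemma run_ifEq e1 e2 c1 c2 s T (Q : store -> Prop) :
  safe s e1 -> safe s e2 ->
  (eval s e1 == eval s e2 -> run c1 s T Q) ->
  (eval s e1 != eval s e2 -> run c2 s T Q) ->
  run (IfEq e1 e2 c1 c2) s (size (test_code e1 e2) + 2 + T) Q.
Proof.
move=> s1 s2 H1 H2; case: (boolP (eval s e1 == eval s e2)) => h.
  case: (H1 h) => t [s' [E ht HQ]].
  by do 2!eexists; split; [exact: ExecIfEqT E | lia |].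
case: (H2 h) => t [s' [E ht HQ]].
by do 2!eexists; split; [exact: ExecIfEqF E | lia |].
Qed.

(** The loop itself performs the increment, hence [set_var s2 x k.+1] in the premise on the body.
    The cost may depend on [k], as the scans differ in length from column to column. *)
Lemma run_for x e c s lo N cost (I : nat -> store -> Prop) :
  x < base_reg -> x \notin written_vars c -> var s x = lo -> lo <= N -> N < W ->
  (forall s', framed (For x e c) s s' -> safe s' e /\ eval s' e = N) ->
  I lo s ->
  (forall k s', lo <= k < N -> var s' x = k -> framed (For x e c) s s' ->
     I k s' -> run c s' (cost k) (fun s2 => I k.+1 (set_var s2 x k.+1))) ->
  run (For x e c) s
    (\sum_(lo <= k < N) (cost k + (size (exp_code e tmp) + 4)) +
       (size (exp_code e tmp) + 2))
    (fun s' => var s' x = N /\ I N s').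
Proof.
move=> hx xc e0 le0 hN He I0 Hc.
suff H d k s' : N - k < d -> lo <= k <= N -> framed (For x e c) s s' ->
    var s' x = k -> I k s' ->
    run (For x e c) s'
      (\sum_(k <= k' < N) (cost k' + (size (exp_code e tmp) + 4)) +
         (size (exp_code e tmp) + 2))
      (fun s' => var s' x = N /\ I N s').
  by apply: (H (N - lo).+1); rewrite ?leqnn.
elim: d k s' => // d IH k s' hd /andP[lo_k hk] F' ek Ik.
have [sf ev] := He _ F'; have [ltkN|leNk] := ltnP k N; last first.
  have eN : k = N by lia.
  rewrite eN big_geq // add0n; exists (size (exp_code e tmp) + 2), s'; split=> //.
    by apply: ExecForDone; rewrite // ev ek eN.
  by rewrite -eN.
case: (Hc k s') => [|//|//|//|t [s2 [E ht I2]]]; first by rewrite lo_k.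
have e2 : var s2 x = k by have [/(_ x xc) -> _] := exec_framed E.
have F2 : framed (For x e c) s (set_var s2 x k.+1).
  apply: (same_off_trans F').
  have [v2 a2] := exec_framed E; split=> //= i; rewrite inE negb_or.
  by case/andP=> ni /v2<-; rewrite upd_neq.
case: (IH k.+1 (set_var s2 x k.+1)) => //; try lia.
  by rewrite /= upd_eq.
move=> t2 [s3 [E3 ht2 H3]]; exists (size (exp_code e tmp) + 1 + t + 3 + t2), s3.
split=> //; last by rewrite big_ltn //; lia.
by apply: ExecForStep E _ _; rewrite ?ev ?ek ?e2 //; lia.
Qed.

(** * Weakest preconditions and costs of loop-free commands *)

Fixpoint max_cost (c : cmd) : nat :=
  match c with
  | Asg _ e => size (exp_code e tmp) + 2
  | Put _ e1 e2 => size (exp_code e1 tmp) + 5 + size (exp_code e2 tmp.+1) + 1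
  | Seq c1 c2 => max_cost c1 + max_cost c2
  | IfEq e1 e2 c1 c2 | IfLt e1 e2 c1 c2 =>
    size (test_code e1 e2) + 2 + maxn (max_cost c1) (max_cost c2)
  | Skip | For _ _ _ => 0
  end.

Fixpoint wp (c : cmd) (Q : store -> Prop) (s : store) : Prop :=
  match c with
  | Skip => Q s
  | Asg d e =>
    [/\ d < base_reg, safe s e, eval s e < W & Q (set_var s d (eval s e))]
  | Put q e1 e2 =>
    [/\ q < 8, safe s e1, safe s e2, eval s e1 < X &
        Q (set_arr s q (eval s e1) (eval s e2))]
  | Seq c1 c2 => wp c1 (wp c2 Q) s
  | IfEq e1 e2 c1 c2 =>
    [/\ safe s e1, safe s e2 &
        if eval s e1 == eval s e2 then wp c1 Q s else wp c2 Q s]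
  | IfLt e1 e2 c1 c2 =>
    [/\ safe s e1, safe s e2 &
        if eval s e1 < eval s e2 then wp c1 Q s else wp c2 Q s]
  | For _ _ _ => False
  end.

Lemma wp_run c s (Q : store -> Prop) : wp c Q s -> run c s (max_cost c) Q.
Proof.
elim: c s Q => [|d e|q e1 e2|c1 IH1 c2 IH2|e1 e2 c1 IH1 c2 IH2
  |e1 e2 c1 IH1 c2 IH2|//] s Q /=.
- by move=> HQ; exists 0, s; split=> //; constructor.
- by case=> *; do 2!eexists; split; first by constructor.
- by case=> *; do 2!eexists; split; first by constructor.
- by move/IH1=> H; apply: run_seq; apply: run_weaken H _ _ => // s' _ /IH2.
- case=> s1 s2 H; apply: run_ifEq => // h.
    by rewrite h in H; apply: run_weaken (IH1 _ _ H) _ _; rewrite ?leq_maxl.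
  rewrite (negPf h) in H.
  by apply: run_weaken (IH2 _ _ H) _ _; rewrite ?leq_maxr.
case=> s1 s2 H; apply: run_ifLt => // h.
  by rewrite h in H; apply: run_weaken (IH1 _ _ H) _ _; rewrite ?leq_maxl.
rewrite ltnNge h in H.
by apply: run_weaken (IH2 _ _ H) _ _; rewrite ?leq_maxr.
Qed.

End Semantics.

(** * Longest common subsequences *)

(** Enumerating subsequences by their masks gives the maximum a finite index type. *)
Definition lcs (x y : seq nat) : nat :=
  \max_(m : (size x).-tuple bool | subseq (mask m x) y) size (mask m x).

Lemma leq_lcs s x y : subseq s x -> subseq s y -> size s <= lcs x y.
Proof.
case/subseqP=> m sm -> sy; rewrite /lcs.
have szm : size m == size x by apply/eqP.
exact: (@leq_bigmax_cond _ (fun m : (size x).-tuple bool => subseq (mask m x) y)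
  (fun m => size (mask m x)) (Tuple szm)).
Qed.

Lemma lcs_witness x y :
  exists s, [/\ subseq s x, subseq s y & size s = lcs x y].
Proof.
have [|m sy E] := @eq_bigmax_cond _ [pred m : (size x).-tuple bool |
  subseq (mask m x) y] (fun m => size (mask m x)).
  apply/card_gt0P; exists (nseq_tuple (size x) false).
  by rewrite inE /= mask_false sub0seq.
by exists (mask m x); rewrite mask_subseq.
Qed.

Lemma lcs_leP x y n :
  (forall s, subseq s x -> subseq s y -> size s <= n) <-> lcs x y <= n.
Proof.
split=> [H | le_n s sx sy]; last exact: leq_trans (leq_lcs sx sy) le_n.
by have [s [sx sy <-]] := lcs_witness x y; apply: H.
Qed.

Lemma lcs_sub x y x' y' : subseq x x' -> subseq y y' -> lcs x y <= lcs x' y'.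
Proof.
move=> hx hy; apply/lcs_leP=> s sx sy.
exact: leq_lcs (subseq_trans sx hx) (subseq_trans sy hy).
Qed.

Lemma lcs_leq_size x y : lcs x y <= size y.
Proof. by apply/lcs_leP => s _ /size_subseq. Qed.

Lemma lcs0l y : lcs [::] y = 0.
Proof.
by apply/eqP; rewrite -leqn0; apply/lcs_leP => s; rewrite subseq0 => /eqP->.
Qed.

Lemma lcs0r x : lcs x [::] = 0.
Proof. by apply/eqP; rewrite -leqn0 lcs_leq_size. Qed.

Lemma lcs_rev x y : lcs (rev x) (rev y) = lcs x y.
Proof.
have H x' y' : lcs x' y' <= lcs (rev x') (rev y').
  by apply/lcs_leP => s sx sy; rewrite -size_rev leq_lcs ?subseq_rev.
by apply/eqP; rewrite eqn_leq H andbT -{2}[x]revK -{2}[y]revK H.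
Qed.

Lemma lcs_cons a b x y :
  lcs (a :: x) (b :: y) =
  if a == b then (lcs x y).+1 else maxn (lcs x (b :: y)) (lcs (a :: x) y).
Proof.
case: eqP => [<-|/eqP neq]; apply/eqP; rewrite eqn_leq; apply/andP; split.
- apply/lcs_leP=> -[|c s] //=; case: eqP => _ sx sy.
    by rewrite ltnS leq_lcs.
  by rewrite leqW // (@leq_lcs (c :: s)).
- have [s [sx sy <-]] := lcs_witness x y.
  by rewrite (@leq_lcs (a :: s)) //= eqxx.
- apply/lcs_leP=> s; case: s => [|c s] // sx sy; rewrite leq_max.
  have [ec | nc] := eqVneq c a; last first.
    by rewrite leq_lcs //; move: sx; rewrite /= (negPf nc).
  by rewrite orbC leq_lcs //; move: sy; rewrite /= ec (negPf neq).
by rewrite geq_max !lcs_sub ?subseq_refl ?subseq_cons.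
Qed.

Lemma lcs_rcons a b x y :
  lcs (rcons x a) (rcons y b) =
  if a == b then (lcs x y).+1
  else maxn (lcs x (rcons y b)) (lcs (rcons x a) y).
Proof.
rewrite -lcs_rev !rev_rcons lcs_cons -[lcs x y]lcs_rev -[lcs x _]lcs_rev.
by rewrite -[lcs (rcons x a) y]lcs_rev !rev_rcons.
Qed.

Lemma subseq_cat_split (s x1 x2 : seq nat) : subseq s (x1 ++ x2) ->
  exists s1 s2, [/\ s = s1 ++ s2, subseq s1 x1 & subseq s2 x2].
Proof.
case/subseqP=> m sm ->; exists (mask (take (size x1) m) x1).
exists (mask (drop (size x1) m) x2); split; try exact: mask_subseq.
by rewrite -mask_cat ?cat_take_drop // size_takel // sm size_cat leq_addr.
Qed.

Lemma cat_subseq_split (s1 s2 y : seq nat) : subseq (s1 ++ s2) y ->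
  exists y1 y2, [/\ y = y1 ++ y2, subseq s1 y1 & subseq s2 y2].
Proof.
elim: y s1 => [|b y IH] s1; first by case: s1 s2 => [|? ?] [|? ?] //; exists [::], [::].
case: s1 => [|a s1] h; first by exists [::], (b :: y).
move: h => /=; case: eqP => [->|ne] /=.
  by case/IH=> y1 [y2 [-> h1 h2]]; exists (b :: y1), y2; rewrite /= eqxx.
case/(IH (a :: s1)) => y1 [y2 [-> h1 h2]]; exists (b :: y1), y2; split=> //.
exact: subseq_trans h1 (subseq_cons _ _).
Qed.

Lemma leq_lcs_cat x1 x2 y1 y2 :
  lcs x1 y1 + lcs x2 y2 <= lcs (x1 ++ x2) (y1 ++ y2).
Proof.
have [s1 [a1 b1 <-]] := lcs_witness x1 y1.
have [s2 [a2 b2 <-]] := lcs_witness x2 y2.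
by rewrite -size_cat leq_lcs ?cat_subseq.
Qed.

(** A longest common subsequence splits along [x1 ++ x2], and an embedding of its two pieces into
    [y] fixes the cut. *)
Lemma lcs_cat_split x1 x2 y : exists2 k, k <= size y &
  lcs (x1 ++ x2) y = lcs x1 (take k y) + lcs x2 (drop k y).
Proof.
have [s [sx sy E]] := lcs_witness (x1 ++ x2) y.
have [s1 [s2 [es h1 h2]]] := subseq_cat_split sx.
rewrite {}es in sx sy E.
have [y1 [y2 [ey g1 g2]]] := cat_subseq_split sy.
have le1 := leq_lcs h1 g1; have le2 := leq_lcs h2 g2.
exists (size y1); first by rewrite ey size_cat leq_addr.
have et : take (size y1) y = y1 by rewrite ey take_size_cat.
have ed : drop (size y1) y = y2 by rewrite ey drop_size_cat.
apply/eqP; rewrite eqn_leq et ed -E size_cat leq_add //=.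
by rewrite -size_cat E ey leq_lcs_cat.
Qed.

(** * Seaweed thresholds *)

Section Thresholds.

Variables (xs ys : nat -> nat).

(* One row of the combing: [h k] is the threshold entering column [k] from
   above, and the accumulator is the threshold entering it from the left; the
   two cross unless they already crossed before or the letters match. *)
Fixpoint comb_left (e : pred nat) (h : nat -> nat) (k : nat) : nat :=
  if k is k'.+1 then
    let u := comb_left e h k' in if e k' || (h k' < u) then h k' else u
  else 0.

Definition comb_down (e : pred nat) (h : nat -> nat) (k : nat) : nat :=
  let u := comb_left e h k in if e k || (h k < u) then u else h k.

(** The start [succn] lies beyond every admissible j <= k: against the empty word there is no
    increment. *)
Fixpoint thr (t : nat) : nat -> nat :=
  if t is t'.+1 then comb_down (fun k => xs t' == ys k) (thr t') else succn.

Definition vthr (t : nat) : nat -> nat :=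
  comb_left (fun k => xs t == ys k) (thr t).

(** On the diagonal j = k the table is 0 in every row, so no vertical increment may occur there;
    this starts the induction over columns in [thr_vthrP]. *)
Lemma thr_vthr_le t k : thr t k <= k.+1 /\ vthr t k <= k.
Proof.
elim: t k => [|t IH] k.
  split=> //; rewrite /vthr; elim: k => //= k IHk; set u := comb_left _ _ _ in IHk *.
  by case: ifP => _ //; rewrite leqW.
have Hv t' k' : (forall k, thr t' k <= k.+1) -> vthr t' k' <= k'.
  move=> H; elim: k' => // k' IHk; rewrite /vthr /= -/(vthr t' k').
  by case: ifP => _ //; rewrite leqW.
have Hh k' : thr t.+1 k' <= k'.+1.
  rewrite /= /comb_down -/(vthr t k'); have [h1 h2] := IH k'.
  by case: ifP => _ //; rewrite leqW.
by split; [|apply: Hv].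
Qed.

Variables (L : nat -> nat -> nat -> nat) (T n : nat).
Hypothesis L0 : forall j k, j <= k <= n -> L 0 j k = 0.
Hypothesis Ljj : forall t j, t <= T -> L t j j = 0.
Hypothesis Lrec : forall t j k, t < T -> j <= k < n ->
  L t.+1 j k.+1 =
  if xs t == ys k then (L t j k).+1 else maxn (L t j k.+1) (L t.+1 j k).

(** Let h and u be the thresholds entering the cell from above and from the left. On a match the new
    value is L + 1, so each new increment complements the opposite old one and the thresholds swap.
    Without a match, if h < u then every j has h <= j or j < u, the maximum is again L + 1 and they
    swap; if u <= h, at most one increment is 1 and both pass through unchanged. *)
Lemma thr_cell t j k : t < T -> j <= k < n ->
  L t j k.+1 = L t j k + (thr t k <= j) ->
  L t.+1 j k = L t j k + (j < vthr t k) ->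
  L t.+1 j k.+1 = L t.+1 j k + (thr t.+1 k <= j) /\
  L t.+1 j k.+1 = L t j k.+1 + (j < vthr t k.+1).
Proof.
move=> tT jkn eh ev; rewrite Lrec // eh ev /= /comb_down /vthr /=.
rewrite -/(vthr t k); case: (xs t == ys k) => /=; first by lia.
by case: (ltnP (thr t k)) => hu; lia.
Qed.

(** The two rules are proved jointly: horizontal increments of row t yield the vertical ones by a
    sweep from the diagonal, and both yield the horizontal ones of row t + 1. *)
Lemma thr_vthrP t : t <= T ->
  (forall j k, j <= k < n -> L t j k.+1 = L t j k + (thr t k <= j)) /\
  (t < T -> forall j k, j <= k <= n -> L t.+1 j k = L t j k + (j < vthr t k)).
Proof.
have vert t' : t' < T ->
    (forall j k, j <= k < n -> L t' j k.+1 = L t' j k + (thr t' k <= j)) ->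
    forall j k, j <= k <= n -> L t'.+1 j k = L t' j k + (j < vthr t' k).
  move=> tT eh j k /andP[jk]; rewrite -(subnKC jk).
  elim: (k - j) => [|d IH] jn.
    by rewrite addn0 !Ljj ?(ltnW tT) // ltnNge (thr_vthr_le t' j).2.
  have jd : j <= j + d < n by lia.
  rewrite addnS; have [|_ ->] // := thr_cell tT jd (eh _ _ jd).
  by apply: IH; lia.
elim: t => [|t IH] tT; last first.
  have [eh /(_ tT) ev] := IH (ltnW tT).
  have eh' j k : j <= k < n -> L t.+1 j k.+1 = L t.+1 j k + (thr t.+1 k <= j).
    move=> jk; have [|-> _] // := thr_cell tT jk (eh _ _ jk).
    by apply: ev; lia.
  by split=> // tT'; apply: vert.
have eh j k : j <= k < n -> L 0 j k.+1 = L 0 j k + (thr 0 k <= j).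
  by move=> jk; rewrite !L0 /=; lia.
by split=> // tT'; apply: vert.
Qed.

Lemma thrP t j k : t <= T -> j <= k < n ->
  L t j k.+1 = L t j k + (thr t k <= j).
Proof. by case/thr_vthrP=> H _ /H. Qed.

Lemma vthrP t j k : t < T -> j <= k <= n ->
  L t.+1 j k = L t j k + (j < vthr t k).
Proof. by move=> h; case: (thr_vthrP (ltnW h)) => _ /(_ h) H /H. Qed.

Hypothesis Lmono : forall t j k, t <= T -> j < k <= n -> L t j.+1 k <= L t j k.

(** The increments for j and j + 1 differ exactly in columns with threshold j + 1, and each such
    column lowers the difference of the two table entries by one. Without a hit it is 1, and [Lmono]
    forbids it to become negative. *)
Lemma thr_hit t j k : t <= T -> j < k <= n ->
  L t j k = L t j.+1 k + ~~ has (fun i => thr t i == j.+1) (index_iota j k).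
Proof.
move=> tT /andP[jk]; rewrite -(subnKC jk); elim: (k - j.+1) => [|d IH] kn.
  rewrite addn0 thrP ?leqnn //; last by lia.
  rewrite !Ljj // /index_iota subSnn /= orbF.
  by have [h _] := thr_vthr_le t j; lia.
have dn : j.+1 + d < n by rewrite -addnS.
have jd : j < j.+1 + d by lia.
have := IH (ltnW dn); rewrite addnS.
move: (j.+1 + d) jd dn => i ji iN {IH kn} IH.
have -> : index_iota j i.+1 = rcons (index_iota j i) i.
  rewrite /index_iota subSn; last by lia.
  by rewrite -[(_ - j).+1]addn1 iotaD subnKC ?cats1 //; lia.
have := @Lmono t j i.+1 tT; rewrite !thrP //; try lia.
by rewrite has_rcons IH negb_or; case: (has _ _) => /=; lia.
Qed.

(** A second column with the same positive threshold would make the difference in [thr_hit]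
    negative. *)
Lemma thr_inj t j k1 k2 : t <= T -> k1 < n -> k2 < n ->
  thr t k1 = j.+1 -> thr t k2 = j.+1 -> k1 = k2.
Proof.
move=> tT; wlog lt12 : k1 k2 / k1 < k2.
  move=> H h1 h2 e1 e2; case: (ltngtP k1 k2) => // lt; first exact: H.
  by apply/esym/H.
move=> h1 h2 e1 e2; have [jk1 _] := thr_vthr_le t k1.
have jk2 : j < k2 <= n by lia.
have jk3 : j < k2.+1 <= n by lia.
have := thr_hit tT jk2; have := thr_hit tT jk3; have := Lmono tT jk3.
rewrite !thrP //; try lia.
have -> : has (fun i => thr t i == j.+1) (index_iota j k2).
  by apply/hasP; exists k1; rewrite ?mem_index_iota ?e1 //; lia.
have -> : has (fun i => thr t i == j.+1) (index_iota j k2.+1).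
  by apply/hasP; exists k1; rewrite ?mem_index_iota ?e1 //; lia.
by rewrite e2; lia.
Qed.

(** The sentinel [n] stands for a value that no column takes: the test [k <= g j] then succeeds for
    every k <= n, as [thr_hit] requires. *)
Definition inverse_thr (t : nat) (g : nat -> nat) : Prop :=
  forall j, j < n ->
    (exists2 k, k < n & thr t k = j.+1 /\ g j = k) \/
    (g j = n /\ forall k, k < n -> thr t k <> j.+1).

Lemma inverse_thrP t g j k : t <= T -> inverse_thr t g -> j < k <= n ->
  L t j k = L t j.+1 k + (k <= g j).
Proof.
move=> tT Hg jk; rewrite (thr_hit tT jk); congr (_ + nat_of_bool _).
have jn : j < n by lia.
case: (Hg j jn) => [[i iN [ei ->]]|[-> H]]; last first.
  rewrite (andP jk).2; apply/hasPn => i; rewrite mem_index_iota => hi.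
  by apply/eqP/H; lia.
have [ji _] := thr_vthr_le t i.
have [ki|ik] := leqP k i.
  apply/hasPn => i'; rewrite mem_index_iota => hi; apply/eqP => e'.
  by have := thr_inj tT _ iN e' ei; lia.
apply/negbTE/negPn/hasP; exists i; last by rewrite ei.
by rewrite mem_index_iota; lia.
Qed.

End Thresholds.

(** * Tables of LCS values against all factors of a word *)

Definition seg (y : seq nat) (j k : nat) : seq nat := take (k - j) (drop j y).

(** The semi-local LCS table: a factor of [x] growing with [t], against all factors of [y]. *)
Definition grid (x y : seq nat) (r t j k : nat) : nat :=
  lcs (take t (drop r x)) (seg y j k).

Lemma seg_rcons y j k : j <= k < size y ->
  seg y j k.+1 = rcons (seg y j k) (nth 0 y k).
Proof.
move=> /andP[jk kn]; rewrite /seg subSn // (take_nth 0) ?nth_drop ?subnKC //.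
by rewrite size_drop; lia.
Qed.

Lemma size_seg y j k : j <= k <= size y -> size (seg y j k) = k - j.
Proof. by move=> jk; rewrite size_takel // size_drop; lia. Qed.

Lemma grid0 x y r j k : grid x y r 0 j k = 0.
Proof. by rewrite /grid take0 lcs0l. Qed.

Lemma grid_refl x y r t j : grid x y r t j j = 0.
Proof. by rewrite /grid /seg subnn take0 lcs0r. Qed.

Lemma grid_mono x y r t j k : j < k <= size y ->
  grid x y r t j.+1 k <= grid x y r t j k.
Proof.
move=> jk; apply: lcs_sub; first exact: subseq_refl.
rewrite /seg -[k - j]subnSK ?[drop j y](drop_nth 0); try lia.
exact: subseq_cons.
Qed.

Lemma grid_le x y r t j k : j <= k <= size y -> grid x y r t j k <= k - j.
Proof. by move=> jk; rewrite -(size_seg jk) lcs_leq_size. Qed.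

Section Grid.

Variables (x y : seq nat) (r T : nat).
Hypothesis rT : r + T <= size x.
Local Notation n := (size y).
Local Notation xs := (fun t => nth 0 x (r + t)).
Local Notation ys := (nth 0 y).
Local Notation L := (grid x y r).

Lemma grid_rec t j k : t < T -> j <= k < n ->
  L t.+1 j k.+1 =
  if xs t == ys k then (L t j k).+1 else maxn (L t j k.+1) (L t.+1 j k).
Proof.
move=> tT jk; rewrite /grid (take_nth 0) ?size_drop; last by lia.
by rewrite seg_rcons // lcs_rcons nth_drop.
Qed.

Lemma grid_thr t j k : t <= T -> j <= k < n ->
  L t j k.+1 = L t j k + (thr xs ys t k <= j).
Proof.
by apply: (thrP _ _ grid_rec) => [i l _|i l _]; rewrite ?grid0 ?grid_refl.
Qed.

Lemma grid_vthr t j k : t < T -> j <= k <= n ->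
  L t.+1 j k = L t j k + (j < vthr xs ys t k).
Proof.
by apply: (vthrP _ _ grid_rec) => [i l _|i l _]; rewrite ?grid0 ?grid_refl.
Qed.

Lemma grid_inv t g j k : t <= T -> inverse_thr xs ys n t g -> j < k <= n ->
  L t j k = L t j.+1 k + (k <= g j).
Proof.
apply: (inverse_thrP _ _ grid_rec) => [i l _|i l _|i l l' _];
  by rewrite ?grid0 ?grid_refl //; apply: grid_mono.
Qed.

Lemma grid_thr_inj t j k1 k2 : t <= T -> k1 < n -> k2 < n ->
  thr xs ys t k1 = j.+1 -> thr xs ys t k2 = j.+1 -> k1 = k2.
Proof.
apply: (thr_inj _ _ grid_rec) => [i l _|i l _|i l l' _];
  by rewrite ?grid0 ?grid_refl //; apply: grid_mono.
Qed.

End Grid.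

Lemma seg_rev y j k : j <= k <= size y ->
  seg (rev y) (size y - k) (size y - j) = rev (seg y j k).
Proof.
move=> jk; rewrite /seg drop_rev subKn ?(andP jk).2 // take_rev.
rewrite size_takel ?(andP jk).2 //; congr rev.
rewrite [X in drop X _](_ : _ = j); last by lia.
by rewrite -{1}(subnK (andP jk).1) take_drop.
Qed.

(** * Leftmost maximisers *)

Definition is_argmax (f : nat -> nat) (lo hi o : nat) : Prop :=
  [/\ lo <= o <= hi, forall k, lo <= k <= hi -> f k <= f o &
      forall k, lo <= k < o -> f k < f o].

Fixpoint argmax (f : nat -> nat) (lo c : nat) : nat :=
  if c is c'.+1 then
    let o := argmax f lo c' in if f o < f (lo + c) then lo + c else o
  else lo.

Lemma argmaxP f lo c : is_argmax f lo (lo + c) (argmax f lo c).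
Proof.
elim: c => [|c [oP oM oL]].
  rewrite addn0; split=> [|k|k]; rewrite ?leqnn //.
    by rewrite -eqn_leq => /eqP->.
  by case: ltngtP.
rewrite /=; case: ltnP => h; split; try lia.
- move=> k /andP[lok]; rewrite leq_eqVlt => /orP[/eqP->//|hk].
  by apply/ltnW/(leq_ltn_trans _ h)/oM; lia.
- by move=> k hk; apply: (leq_ltn_trans _ h); apply: oM; lia.
- move=> k /andP[lok]; rewrite leq_eqVlt => /orP[/eqP->//|hk].
  by apply/oM; lia.
by move=> k hk; apply: oL.
Qed.

(** If o2 < o1, then f1 o2 < f1 o1 because o1 is leftmost; the single-crossing hypothesis carries
    this over to f2, against the maximality of o2. The order of the range ends puts both points in
    both ranges in that case. *)
Lemma argmax_mono f1 f2 lo1 hi1 lo2 hi2 o1 o2 :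
  is_argmax f1 lo1 hi1 o1 -> is_argmax f2 lo2 hi2 o2 ->
  lo1 <= lo2 -> hi1 <= hi2 ->
  (forall k k', lo2 <= k -> k < k' -> k' <= hi1 -> f1 k < f1 k' ->
     f2 k < f2 k') -> o1 <= o2.
Proof.
case=> [b1 _ l1] [b2 m2 _] hlo hhi H; rewrite leqNgt; apply/negP => lt.
have h : f1 o2 < f1 o1 by apply: l1; lia.
have : f2 o2 < f2 o1 by apply: H h; lia.
by rewrite ltnNge m2 //; lia.
Qed.

Lemma argmax_restrict f lo hi lo' hi' o :
  is_argmax f lo hi o -> lo <= lo' <= o -> o <= hi' <= hi ->
  is_argmax f lo' hi' o.
Proof.
case=> [b m l] h1 h2; split; first lia.
  by move=> k hk; apply: m; lia.
by move=> k hk; apply: l; lia.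
Qed.

Lemma argmax_uniq f lo hi o1 o2 :
  is_argmax f lo hi o1 -> is_argmax f lo hi o2 -> o1 = o2.
Proof.
by move=> H1 H2; apply/eqP; rewrite eqn_leq (argmax_mono H1 H2) ?(argmax_mono H2 H1).
Qed.

(** * Windows that cross a given row *)

Section Strip.

Variables (v w : seq nat) (B r : nat).
Local Notation m := (size v).
Local Notation n := (size w).
Hypotheses (Br : B <= r <= m) (Bn : B <= n).

(** Letters of [v] read upwards from the cut, so that combing adds a row where the upper part of a
    window grows. *)
Definition xsA (t : nat) : nat := nth 0 (rev v) (m - r + t).
Definition ysA (k : nat) : nat := nth 0 (rev w) k.
Definition xsC (t : nat) : nat := nth 0 v (r + t).
Definition ysC (k : nat) : nat := nth 0 w k.
(** A window with [d] rows below the cut needs d <= B to reach the cut and d <= m - r to end inside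
    [v]. *)
Definition depth : nat := minn B (m - r).

Let rA : m - r + B <= size (rev v). Proof. by rewrite size_rev; lia. Qed.
Let rC : r + depth <= m. Proof. rewrite /depth; lia. Qed.
Let sw : size (rev w) = n. Proof. exact: size_rev. Qed.

Local Notation gridA := (grid (rev v) (rev w) (m - r)).
Local Notation gridC := (grid v w r).

Lemma gridA_thr t j k : t <= B -> j <= k < n ->
  gridA t j k.+1 = gridA t j k + (thr xsA ysA t k <= j).
Proof. by move=> tB jk; rewrite (grid_thr rA) ?sw. Qed.

Lemma gridC_thr t j k : t <= depth -> j <= k < n ->
  gridC t j k.+1 = gridC t j k + (thr xsC ysC t k <= j).
Proof. exact: (grid_thr rC). Qed.

Lemma gridA_inv t g j k : t <= B -> inverse_thr xsA ysA n t g -> j < k <= n ->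
  gridA t j k = gridA t j.+1 k + (k <= g j).
Proof. by move=> tB; rewrite -sw; apply: (grid_inv rA). Qed.

Lemma gridC_inv t g j k : t <= depth -> inverse_thr xsC ysC n t g ->
  j < k <= n -> gridC t j k = gridC t j.+1 k + (k <= g j).
Proof. exact: (grid_inv rC). Qed.

Lemma gridA_vthr t j k : t < B -> j <= k <= n ->
  gridA t.+1 j k = gridA t j k + (j < vthr xsA ysA t k).
Proof. by move=> tB jk; rewrite (grid_vthr rA) ?sw. Qed.

Lemma gridC_vthr t j k : t < depth -> j <= k <= n ->
  gridC t.+1 j k = gridC t j k + (j < vthr xsC ysC t k).
Proof. exact: (grid_vthr rC). Qed.

Lemma thrA_inj t j k1 k2 : t <= B -> k1 < n -> k2 < n ->
  thr xsA ysA t k1 = j.+1 -> thr xsA ysA t k2 = j.+1 -> k1 = k2.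
Proof. by move=> tB h1 h2; apply: (grid_thr_inj rA); rewrite ?sw. Qed.

Lemma thrC_inj t j k1 k2 : t <= depth -> k1 < n -> k2 < n ->
  thr xsC ysC t k1 = j.+1 -> thr xsC ysC t k2 = j.+1 -> k1 = k2.
Proof. exact: (grid_thr_inj rC). Qed.

(* The best alignment of the windows starting at row [r - B + d] and column [j]
   among those crossing row [r] in column [k]; the part above row [r] is
   measured in the reversed words. *)
Definition cross (d j k : nat) : nat :=
  gridA (B - d) (n - k) (n - j) + gridC d k (j + B).

(** The start of the factor moves in both grids: the upper part gains a column and the lower one
    loses it. Additions on both sides avoid truncated subtraction. *)
Lemma cross_k d j k gA gC : d <= depth ->
  inverse_thr xsA ysA n (B - d) gA -> inverse_thr xsC ysC n d gC ->
  j <= k < j + B -> j + B <= n ->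
  cross d j k.+1 + (j + B <= gC k) = cross d j k + (n - j <= gA (n - k.+1)).
Proof.
move=> dT iA iC jk jB; rewrite /cross [gridC d k _](gridC_inv dT iC); last by lia.
have -> : n - k = (n - k.+1).+1 by lia.
by rewrite (gridA_inv _ iA) ?leq_subr //; lia.
Qed.

(** Here the end of the factor moves in both grids, so the thresholds themselves give the change. *)
Lemma cross_j d j k : d <= depth -> j < k <= j + B -> j + B < n ->
  cross d j.+1 k + (thr xsA ysA (B - d) (n - j.+1) <= n - k) =
  cross d j k + (thr xsC ysC d (j + B) <= k).
Proof.
move=> dT jk jB; rewrite /cross addSn gridC_thr //; last by lia.
have -> : n - j = (n - j.+1).+1 by lia.
by rewrite gridA_thr ?leq_subr //; lia.
Qed.

(** The vertical rule serves the monotonicity of the maximisers in [d]; the program starts every row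
    afresh instead of moving [d]. *)
Lemma cross_d d j k : d < depth -> j <= k <= j + B -> j + B <= n ->
  cross d.+1 j k + (n - k < vthr xsA ysA (B - d.+1) (n - j)) =
  cross d j k + (k < vthr xsC ysC d (j + B)).
Proof.
move=> dT jk jB; rewrite /cross gridC_vthr //; last by lia.
have dB : d < B by apply: leq_trans dT _; rewrite /depth; lia.
have -> : B - d = (B - d.+1).+1 by lia.
by rewrite gridA_vthr //; lia.
Qed.

Lemma cross_le d j k : j <= k <= j + B -> j + B <= n -> cross d j k <= B.
Proof.
move=> jk jB; have := @grid_le (rev v) (rev w) (m - r) (B - d) (n - k) (n - j).
rewrite sw /cross; have := @grid_le v w r d k (j + B).
by move=> h1 h2; have := h1 _; have := h2 _; lia.
Qed.

Definition opt (d j : nat) : nat := argmax (cross d j) j B.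

Lemma optP d j : is_argmax (cross d j) j (j + B) (opt d j).
Proof. exact: argmaxP. Qed.

Lemma opt_bounds d j : j <= opt d j <= j + B.
Proof. by case: (optP d j). Qed.

(** By [cross_j] the change from j to j + 1 is [thrC <= k] - [thrA <= n - k], nondecreasing in k;
    strict gains from left to right therefore persist. *)
Lemma opt_mono_j d j : d <= depth -> j + B < n -> opt d j <= opt d j.+1.
Proof.
move=> dT jB; apply: (argmax_mono (optP d j) (optP d j.+1)) => //.
move=> k k' jk kk' k'B.
have := @cross_j d j k dT _ jB; have := @cross_j d j k' dT _ jB.
by move=> h1 h2; have := h1 _; have := h2 _; lia.
Qed.

(** By [cross_d] the change from d to d + 1 is [k < vthrC] - [n - k < vthrA], nonincreasing in k, so
    strict gains persist from d + 1 back to d. *)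
Lemma opt_mono_d d j : d < depth -> j + B <= n -> opt d.+1 j <= opt d j.
Proof.
move=> dT jB; apply: (argmax_mono (optP d.+1 j) (optP d j)) => // k k' jk kk' k'B.
have := @cross_d d j k dT _ jB; have := @cross_d d j k' dT _ jB.
by move=> h1 h2; have := h1 _; have := h2 _; lia.
Qed.

Definition window_lcs (i j : nat) : nat :=
  lcs (take B (drop i v)) (take B (drop j w)).

Lemma crossE d j k : d <= B -> j <= k <= j + B -> j + B <= n ->
  cross d j k = lcs (take (B - d) (drop (r - B + d) v)) (seg w j k) +
    lcs (take d (drop r v)) (seg w k (j + B)).
Proof.
move=> dB jk jB; rewrite /cross /grid seg_rev; last by lia.
congr (_ + _); rewrite -[RHS]lcs_rev; congr (lcs _ _).
rewrite drop_rev subKn ?(andP Br).2 // take_rev size_takel ?(andP Br).2 //.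
congr rev; rewrite [X in drop X _](_ : _ = r - B + d); last by lia.
by rewrite take_drop; congr (drop _ (take _ _)); lia.
Qed.

(** Concatenation gives one inequality; for the other, [lcs_cat_split] supplies a crossing column of
    an optimal alignment. *)
Lemma cross_opt d j : d <= depth -> j + B <= n ->
  cross d j (opt d j) = window_lcs (r - B + d) j.
Proof.
move=> dT jB; have dB : d <= B by apply: leq_trans dT _; rewrite /depth; lia.
have split_v : take B (drop (r - B + d) v) =
    take (B - d) (drop (r - B + d) v) ++ take d (drop r v).
  have -> : drop r v = drop (B - d) (drop (r - B + d) v).
    by rewrite drop_drop; congr drop; lia.
  by rewrite -takeD subnK.
have [ob om _] := optP d j; apply/eqP; rewrite eqn_leq; apply/andP; split.
  rewrite crossE // /window_lcs split_v.
  have -> : take B (drop j w) = seg w j (opt d j) ++ seg w (opt d j) (j + B).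
    have -> : seg w (opt d j) (j + B) =
        take (j + B - opt d j) (drop (opt d j - j) (drop j w)).
      by rewrite drop_drop subnK // (andP ob).1.
    by rewrite /seg -takeD; congr take; lia.
  exact: leq_lcs_cat.
have [k] := lcs_cat_split (take (B - d) (drop (r - B + d) v)) (take d (drop r v))
  (take B (drop j w)).
rewrite size_takel ?size_drop; last by lia.
move=> kB; rewrite /window_lcs split_v => ->.
apply: leq_trans (om (j + k) _); last by lia.
rewrite crossE //; last by lia.
have -> : seg w (j + k) (j + B) = drop k (take B (drop j w)).
  by rewrite /seg subnDl [j + k]addnC -drop_drop take_drop subnK.
by rewrite /seg addKn take_takel.
Qed.

(* In row [d] the optimum of column [j] is searched between that of column
   [j - 1] and that of row [d - 1]; summed over a strip, these ranges
   telescope. *)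
Definition scan_lo (d j : nat) : nat := if j is j'.+1 then maxn j (opt d j') else 0.
Definition scan_hi (d j : nat) : nat := if d is d'.+1 then opt d' j else j + B.

Lemma scan_bounds d j : d <= depth -> j + B <= n ->
  j <= scan_lo d j <= opt d j /\ opt d j <= scan_hi d j <= j + B.
Proof.
move=> dT jB; have ob := opt_bounds d j; split.
  case: j jB ob => [|j] jB ob //=; rewrite geq_max leq_maxl opt_mono_j //.
  by case/andP: ob => ->.
case: d dT ob => [|d] dT ob /=; first by lia.
by rewrite opt_mono_d //; case/andP: (opt_bounds d j).
Qed.

Lemma scan_argmax d j : d <= depth -> j + B <= n ->
  argmax (cross d j) (scan_lo d j) (scan_hi d j - scan_lo d j) = opt d j.
Proof.
move=> dT jB; have [h1 h2] := scan_bounds dT jB.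
have := argmaxP (cross d j) (scan_lo d j) (scan_hi d j - scan_lo d j).
rewrite subnKC; last by lia.
move/argmax_uniq; apply; apply: argmax_restrict (optP d j) _ _ => //.
Qed.

(** Each lower end is at least the optimum of the preceding column, so the lower ends cover all
    optima of the row but the last, which is at most n. *)
Lemma scan_row d : d <= depth ->
  \sum_(0 <= j < (n - B).+1) (scan_hi d j - scan_lo d j) +
    \sum_(0 <= j < (n - B).+1) opt d j <=
  \sum_(0 <= j < (n - B).+1) scan_hi d j + n.
Proof.
move=> dT.
have lo_ge : \sum_(0 <= j < n - B) opt d j <= \sum_(0 <= j < (n - B).+1) scan_lo d j.
  rewrite big_nat_recl // -[leqLHS]add0n leq_add //.
  by apply: leq_sum => j _; rewrite /= leq_maxr.
have -> : \sum_(0 <= j < (n - B).+1) scan_hi d j =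
    \sum_(0 <= j < (n - B).+1) (scan_hi d j - scan_lo d j) +
    \sum_(0 <= j < (n - B).+1) scan_lo d j.
  rewrite -big_split; apply: eq_big_nat => j jn /=; rewrite subnK //.
  by have [|h1 h2] := @scan_bounds d j dT; lia.
rewrite -addnA leq_add2l big_nat_recr //= leq_add //.
by have := opt_bounds d (n - B); lia.
Qed.

(** The upper ends of row d + 1 are the optima of row d, so [scan_row] telescopes. What remains is
    the first sum of upper ends minus the last, at most B per column since upper ends lie between j
    and j + B. *)
Lemma scan_total D : D <= depth.+1 ->
  \sum_(0 <= d < D) \sum_(0 <= j < (n - B).+1) (scan_hi d j - scan_lo d j) <=
  (n - B).+1 * B + D * n.
Proof.
pose S d := \sum_(0 <= j < (n - B).+1) scan_hi d j.
have S0 d : S 0 <= S d + (n - B).+1 * B.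
  rewrite -[(n - B).+1 in X in _ + X]subn0 -sum_nat_const_nat -big_split /=.
  apply: leq_sum => j _; rewrite leq_add2r; case: d => [|d]; first exact: leq_addr.
  by case/andP: (opt_bounds d j).
suff H : D <= depth.+1 ->
    \sum_(0 <= d < D) \sum_(0 <= j < (n - B).+1) (scan_hi d j - scan_lo d j) +
    S D <= S 0 + D * n.
  by move/H; have := S0 D; lia.
elim: D => [|D IH] DT; first by rewrite big_geq // leq_addr.
rewrite big_nat_recr //=; have := IH (ltnW DT); have := scan_row DT.
have -> : S D.+1 = \sum_(0 <= j < (n - B).+1) opt D j by [].
by rewrite -/(S D) mulSn; lia.
Qed.

End Strip.

(** * Covering all windows of the first word by the cuts *)

Section BestWindow.

Variables (v w : seq nat) (B : nat).
Local Notation m := (size v).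
Local Notation n := (size w).

(** As [d] may reach B, some windows are counted at two cuts, which a maximum tolerates. *)
Definition best_window : nat :=
  \max_(0 <= a < m %/ B) \max_(0 <= d < (depth v B (a.+1 * B)).+1)
    \max_(0 <= j < (n - B).+1) window_lcs v w B (a * B + d) j.

Lemma best_window_le : best_window <= B.
Proof.
rewrite /best_window; apply: (big_ind (fun x => x <= B)) => // [x y|a _].
  by rewrite geq_max => -> ->.
apply: (big_ind (fun x => x <= B)) => // [x y|d _]; first by rewrite geq_max => -> ->.
apply: (big_ind (fun x => x <= B)) => // [x y|j _]; first by rewrite geq_max => -> ->.
by apply: leq_trans (lcs_leq_size _ _) _; rewrite size_take_min geq_minl.
Qed.

Hypotheses (B_gt0 : 0 < B) (Bm : B <= m) (Bn : B <= n).

Lemma best_windowP k : is_lcs_br B v w k -> best_window = k.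
Proof.
case=> [[s [[i iB si] [j jB sj]] sk] kmax]; apply/eqP; rewrite eqn_leq.
apply/andP; split.
  apply/bigmax_leqP_seq => a; rewrite mem_index_iota => /andP[_ am] _.
  apply/bigmax_leqP_seq => d; rewrite mem_index_iota ltnS => /andP[_ dT] _.
  apply/bigmax_leqP_seq => l; rewrite mem_index_iota => /andP[_ ln] _.
  have Br : a.+1 * B <= m.
    by apply: leq_trans (leq_trunc_div m B); rewrite leq_mul2r am orbT.
  apply/lcs_leP => s' s'v s'w; apply: kmax; split.
    by exists (a * B + d) => //; move: dT; rewrite /depth; lia.
  by exists l => //; lia.
rewrite -sk; apply: leq_trans (leq_lcs si sj) _.
(* Row i belongs to the cut (i %/ B + 1) * B at offset i %% B; since i + B <= m, this cut and the
   whole window lie inside [v]. *)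
have eij := divn_eq i B; have dB : i %% B < B by rewrite ltn_mod.
have iBm : (i %/ B).+1 * B <= m by lia.
have h1 : i %/ B \in index_iota 0 (m %/ B) by rewrite mem_index_iota /= leq_divRL.
have h2 : i %% B \in index_iota 0 (depth v B ((i %/ B).+1 * B)).+1.
  by rewrite mem_index_iota /depth; lia.
have h3 : j \in index_iota 0 (n - B).+1 by rewrite mem_index_iota; lia.
apply: leq_trans (leq_bigmax_seq _ h1 isT); apply: leq_trans (leq_bigmax_seq _ h2 isT).
by apply: leq_trans (leq_bigmax_seq _ h3 isT); rewrite /window_lcs -eij.
Qed.

End BestWindow.

(** * The program *)

Local Notation vm := 0.
Local Notation vn := 1.
Local Notation vB := 2.
Local Notation vr := 3.
Local Notation va := 4.
Local Notation vT := 5.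
Local Notation vt := 6.
Local Notation vk := 7.
Local Notation vu := 8.
Local Notation vh := 9.
Local Notation vd := 10.
Local Notation vj := 11.
Local Notation vval := 12.
Local Notation vbest := 13.
Local Notation vbk := 14.
Local Notation vans := 15.

Local Notation "$ i" := (Var i) (at level 1, format "$ i").
Local Notation "# i" := (Lit i) (at level 1, format "# i").
Local Notation "e1 [+] e2" := (Bin OpAdd e1 e2) (at level 50, left associativity).
Local Notation "e1 [-] e2" := (Bin OpSub e1 e2) (at level 50, left associativity).
Local Notation "e1 [*] e2" := (Bin OpMul e1 e2) (at level 40, left associativity).
Local Notation "e1 [/] e2" := (Bin OpDiv e1 e2) (at level 40, left associativity).
Local Notation "x ::= e" := (Asg x e) (at level 70).
Local Notation "c1 ;; c2" := (Seq c1 c2) (at level 80, right associativity).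
Local Notation incr x := (Asg x (Var x [+] Lit 1)).
Local Notation decr x := (Asg x (Var x [-] Lit 1)).

(* Arrays 0 and 1 hold the thresholds above and below the cut, arrays 2 and 3 the
   inverses of the two rows in use, and array 4 the upper ends of the search
   ranges.  Row [t] of the thresholds is stored in cells [t * n], ..., [t * n + n - 1]. *)
Definition comb_cell (q : nat) (ex ey : exp) : cmd :=
  let below := ($vt [+] #1) [*] $vn [+] $vk in
  let swap := Put q below $vu ;; vu ::= $vh in
  vh ::= Get q ($vt [*] $vn [+] $vk) ;;
  IfEq ex ey swap (IfLt $vh $vu swap (Put q below $vh)).

Definition comb_row (q : nat) (ex ey : exp) : cmd :=
  vu ::= #0 ;; vk ::= #0 ;; For vk $vn (comb_cell q ex ey).

Definition comb (q : nat) (ex ey eT : exp) : cmd :=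
  (vk ::= #0 ;; For vk $vn (Put q $vk ($vk [+] #1))) ;;
  (vt ::= #0 ;; For vt eT (comb_row q ex ey)).

(** A threshold 0 has no index j with j + 1 = 0 and is skipped; cells that no threshold names keep
    the sentinel of the first loop. *)
Definition invert (q : nat) (et : exp) (qg : nat) : cmd :=
  (vk ::= #0 ;; For vk $vn (Put qg $vk $vn)) ;;
  (vk ::= #0 ;; For vk $vn (
    vh ::= Get q (et [*] $vn [+] $vk) ;;
    IfLt #0 $vh (Put qg ($vh [-] #1) $vk) Skip)).

(** The two tests are the two corrections in [cross_k]. Incrementing first makes the value at least
    1 whenever the decrement happens, so the subtraction is safe. *)
Definition move_k : cmd :=
  IfLt (Get 2 ($vn [-] ($vk [+] #1))) ($vn [-] $vj) Skip (incr vval) ;;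
  IfLt (Get 3 $vk) ($vj [+] $vB) Skip (decr vval).

(** The strict comparison keeps the leftmost maximiser, on which monotonicity rests. *)
Definition scan_step : cmd :=
  move_k ;;
  IfLt $vbest $vval (vbest ::= $vval ;; vbk ::= $vk [+] #1) Skip.

(** [cross_j] presupposes j < k, so k = j is pushed forward first; k ends at max(j + 1, k), the
    lower end of the next search range. *)
Definition move_j : cmd :=
  IfLt $vj $vk Skip (move_k ;; incr vk) ;;
  IfLt $vk (Get 1 ($vd [*] $vn [+] ($vj [+] $vB))) Skip (incr vval) ;;
  IfLt ($vn [-] $vk) (Get 0 (($vB [-] $vd) [*] $vn [+] ($vn [-] ($vj [+] #1))))
    Skip (decr vval).

(** Since [vbest] keeps the optimal value, k returns to the maximiser in constant time and only
    moves to the right are paid for. The entry in array 4 bounds the search of this column in the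
    next row. *)
Definition scan_end : cmd :=
  (Put 4 $vj $vbk ;; IfLt $vans $vbest (vans ::= $vbest) Skip ;;
   vk ::= $vbk ;; vval ::= $vbest) ;;
  IfLt $vj ($vn [-] $vB) move_j Skip.

Definition scan_column : cmd :=
  (vbest ::= $vval ;; vbk ::= $vk) ;; (For vk (Get 4 $vj) scan_step ;; scan_end).

(** At j = k = 0 the upper part faces an empty factor, and the lower summand counts the columns
    below B whose threshold is 0. *)
Definition scan_init : cmd :=
  (vval ::= #0 ;; vk ::= #0) ;;
  For vk $vB (IfLt #0 (Get 1 ($vd [*] $vn [+] $vk)) Skip (incr vval)).

Definition scan_columns : cmd :=
  (vk ::= #0 ;; vj ::= #0) ;; For vj ($vn [+] #1 [-] $vB) scan_column.

Definition row : cmd :=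
  invert 0 ($vB [-] $vd) 2 ;;
  (invert 1 $vd 3 ;; (scan_init ;; scan_columns)).

Definition strip_bounds : cmd :=
  vr ::= ($va [+] #1) [*] $vB ;; vT ::= $vm [-] $vr ;;
  IfLt $vB $vT (vT ::= $vB) Skip.

(** The reversed words are never stored: their letters are read backwards from the input. *)
Definition comb_above : cmd :=
  comb 0 (Inp ($vr [-] ($vt [+] #1))) (Inp ($vm [+] $vn [-] ($vk [+] #1))) $vB.

Definition comb_below : cmd := comb 1 (Inp ($vr [+] $vt)) (Inp ($vm [+] $vk)) $vT.

Definition reset_bounds : cmd :=
  vj ::= #0 ;; For vj ($vn [+] #1 [-] $vB) (Put 4 $vj ($vj [+] $vB)).

Definition rows : cmd := vd ::= #0 ;; For vd ($vT [+] #1) row.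

Definition strip : cmd :=
  strip_bounds ;; (comb_above ;; (comb_below ;; (reset_bounds ;; rows))).

(** Register 0 holds |v| at the start and the answer at the end, hence the closing assignment. *)
Definition main : cmd :=
  IfLt $vm $vB Skip
    ((va ::= #0 ;; vans ::= #0) ;; (For va ($vm [/] $vB) strip ;; vm ::= $vans)).

Lemma idx_lt n t k T : k < n -> t < T -> t * n + k < T * n.
Proof. by move=> kn tT; have := leq_mul2r n t.+1 T; rewrite mulSn tT; lia. Qed.

Lemma idx_inj n t k t' k' : k < n -> k' < n ->
  t * n + k = t' * n + k' -> t = t' /\ k = k'.
Proof.
move=> kn kn' e; suff et : t = t' by split=> //; move: e; rewrite et; lia.
have := congr1 (divn^~ n) e; have n0 : 0 < n by lia.
by rewrite /= !divnMDl // !divn_small // !addn0.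
Qed.

#[local] Arguments upd f i x j /.
#[local] Arguments thr : simpl never.
#[local] Arguments vthr : simpl never.

(** * Correctness and running time of the program *)

Section Verification.

Variables (b M X : nat) (inp : nat -> nat).
Local Notation W := (2 ^ b).
Hypothesis X_lt : M + 8 * X + 8 < W.
Local Notation run := (run b M X inp).
Local Notation wp := (wp b M X inp).
Local Notation safe := (safe b M X inp).
Local Notation eval := (eval inp).

Lemma run_wp c s T (Q : store -> Prop) :
  wp c Q s -> max_cost c <= T -> run c s T Q.
Proof. by move=> H hT; apply: run_weaken (wp_run H) hT _. Qed.

Lemma run_le c s T T' (Q : store -> Prop) : run c s T Q -> T <= T' -> run c s T' Q.
Proof. by move=> H hT; apply: run_weaken H hT _. Qed.

Lemma run_wp_seq c1 c2 s T (Q : store -> Prop) :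
  wp c1 (fun s' => run c2 s' T Q) s -> run (c1 ;; c2) s (max_cost c1 + T) Q.
Proof. by move=> H; apply: run_seq; exact: wp_run. Qed.

Lemma run_for_const x e c s lo N C (I : nat -> store -> Prop) :
  x < base_reg -> x \notin written_vars c -> var s x = lo -> lo <= N -> N < W ->
  (forall s', framed (For x e c) s s' -> safe s' e /\ eval s' e = N) ->
  I lo s ->
  (forall k s', lo <= k < N -> var s' x = k -> framed (For x e c) s s' ->
     I k s' -> run c s' C (fun s2 => I k.+1 (set_var s2 x k.+1))) ->
  run (For x e c) s
    ((N - lo) * (C + (size (exp_code e tmp) + 4)) + (size (exp_code e tmp) + 2))
    (fun s' => var s' x = N /\ I N s').
Proof.
move=> h1 h2 h3 h4 h5 h6 h7 h8.
by rewrite -sum_nat_const_nat; apply: (@run_for _ _ _ _ x e c s lo N (fun=> C)).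
Qed.

Lemma run_comb_init q xs ys n s :
  q < 8 -> var s vn = n -> n <= X ->
  run (vk ::= #0 ;; For vk $vn (Put q $vk ($vk [+] #1))) s (20 * n + 5)
    (fun s' => forall k, k < n -> arr s' q k = thr xs ys 0 k).
Proof.
move=> q8 en nX.
pose I k s' := forall k', k' < k -> arr s' q k' = thr xs ys 0 k'.
apply: run_weaken; first apply: run_wp_seq.
- rewrite /=; split=> //; try lia.
  apply: (@run_for_const _ _ _ _ 0 n 8 I) => //=; first by lia.
    by move=> s' [Fv _]; rewrite Fv.
  move=> k s' kn ek [F _] Ik; apply: run_wp => //=.
  rewrite ek; split=> //; [by split=> //; lia | by lia |].
  move=> k'; rewrite ltnS leq_eqVlt => /orP[/eqP->|hk] /=.
    by rewrite /upd !eqxx addn1.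
  by rewrite eqxx upd_neq ?Ik //; lia.
- by rewrite /= subn0; lia.
by move=> s' _ [_].
Qed.

Lemma run_comb_row q ex ey xs ys n t s :
  q < 8 -> var s vn = n -> var s vt = t -> t.+2 * n <= X ->
  (forall s', same_off [:: vk; vu; vh] [:: q] s s' -> var s' vk < n ->
     [/\ safe s' ex, safe s' ey, eval s' ex = xs t &
         eval s' ey = ys (var s' vk)]) ->
  size (test_code ex ey) <= 20 ->
  (forall t' k, t' <= t -> k < n -> arr s q (t' * n + k) = thr xs ys t' k) ->
  run (comb_row q ex ey) s (70 * n + 8) (fun s' =>
    forall t' k, t' <= t.+1 -> k < n -> arr s' q (t' * n + k) = thr xs ys t' k).
Proof.
move=> q8 en et tX Hxy szxy rows.
pose I k s' := [/\ var s' vu = vthr xs ys t k,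
  forall t' k', t' <= t -> k' < n -> arr s' q (t' * n + k') = thr xs ys t' k' &
  forall k', k' < k -> arr s' q (t.+1 * n + k') = thr xs ys t.+1 k'].
have nX : n <= X by apply: leq_trans tX; rewrite leq_pmull.
apply: run_weaken.
- do 2![apply: run_wp_seq; rewrite /=; split=> //; try lia].
  apply: (@run_for_const _ _ _ _ 0 n 66 I) => //=; first by lia.
    by move=> s' [Fv _]; rewrite Fv.
  move=> k s' kn ek [Fv Fa] [eu Ir Ik].
  have en' : var s' vn = n by rewrite Fv.
  have et' : var s' vt = t by rewrite Fv.
  apply: run_wp; last by rewrite /=; lia.
  have i1 : t * n + k < X by apply: leq_trans tX; apply: idx_lt.
  have i2 : t.+1 * n + k < X by apply: leq_trans tX; apply: idx_lt.
  have nt : t * n <= t.+1 * n by rewrite leq_mul2r leqnSn orbT.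
  have eh : arr s' q (t * n + k) = thr xs ys t k by rewrite Ir.
  have [ht hv] := thr_vthr_le xs ys t k.
  rewrite /= !en' !et' !ek eh.
  have S x : same_off [:: vk; vu; vh] [:: q] s (set_var s' vh x).
    split=> [i|q'] hi; rewrite !inE ?negb_or in hi; last first.
      by rewrite /= Fa // !inE (negPf hi).
    case/and3P: hi => h1 h2 h3.
    by rewrite /= (negPf h3) Fv /= ?(negPf h1) ?(negPf h2) // !inE
      (negPf h1) (negPf h2) (negPf h3).
  have [|sx sy -> ->] := Hxy _ (S (thr xs ys t k)); first by rewrite /= ek.
  have tW : t.+1 < W by have := leq_pmulr t.+1 (leq_ltn_trans (leq0n k) kn); lia.
  (* Every branch of the cell amounts to one write in row t + 1 and a new accumulator. Rows up to t
     survive because t' * n + k' with k' < n determines t'. *)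
  have post s2 : arr s2 q = upd (arr s' q) (t.+1 * n + k) (thr xs ys t.+1 k) ->
      var s2 vu = vthr xs ys t k.+1 -> I k.+1 s2.
    move=> ea eu2; split=> // [t' k' tt kn'|k'].
      rewrite ea /=; case: eqP => [/(idx_inj kn' kn)[]|_]; first by lia.
      exact: Ir.
    rewrite ltnS leq_eqVlt ea => /orP[/eqP->|hk] /=; first by rewrite eqxx.
    by rewrite eqn_add2l ifF ?Ik //; lia.
  clearbody I; rewrite addn1 /= ek eu; split=> //; [by repeat split; lia | by lia |].
  have unf : (thr xs ys t.+1 k = if (xs t == ys k) || (thr xs ys t k < vthr xs ys t k)
      then vthr xs ys t k else thr xs ys t k) /\
    (vthr xs ys t k.+1 = if (xs t == ys k) || (thr xs ys t k < vthr xs ys t k)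
      then thr xs ys t k else vthr xs ys t k) by [].
  case: unf => unf1 unf2.
  split=> //; case: eqP => [e|_] in unf1 unf2 *; last split=> //.
  - by do ![split=> //; try lia]; apply: post; rewrite /= ?unf1 ?unf2 ?eqxx.
  case: ifP => hlt; rewrite hlt in unf1 unf2;
    by do ![split=> //; try lia]; apply: post; rewrite /= ?eu ?unf1 ?unf2 ?eqxx.
- by rewrite /=; lia.
move=> s' _ [_ [_ Ir Ik]] t' k; rewrite leq_eqVlt ltnS => /orP[/eqP->|]; first exact: Ik.
exact: Ir.
Qed.

Lemma run_comb q ex ey eT xs ys n T s :
  q < 8 -> var s vn = n -> T.+1 * n <= X -> T < W ->
  (forall s', same_off [:: vk; vt; vu; vh] [:: q] s s' ->
     safe s' eT /\ eval s' eT = T) ->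
  (forall s', same_off [:: vk; vt; vu; vh] [:: q] s s' -> var s' vt < T ->
     var s' vk < n ->
     [/\ safe s' ex, safe s' ey, eval s' ex = xs (var s' vt) &
         eval s' ey = ys (var s' vk)]) ->
  size (test_code ex ey) <= 20 -> size (exp_code eT tmp) <= 10 ->
  run (comb q ex ey eT) s (T * (70 * n + 30) + 20 * n + 20) (fun s' =>
    forall t k, t <= T -> k < n -> arr s' q (t * n + k) = thr xs ys t k).
Proof.
move=> q8 en TX TW HT Hxy szxy szT.
have nX : n <= X by apply: leq_trans TX; rewrite leq_pmull.
have sub3 : {subset [:: vk; vu; vh] <= [:: vk; vt; vu; vh]}.
  by move=> i; rewrite !inE => /or3P[]->; rewrite ?orbT.
have S1 s' : framed (vk ::= #0 ;; For vk $vn (Put q $vk ($vk [+] #1))) s s' ->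
    same_off [:: vk; vt; vu; vh] [:: q] s s'.
  by apply: same_off_sub => i; rewrite !inE ?orbb => // ->.
have S2 s' s2 : framed (For vt eT (comb_row q ex ey)) s' s2 ->
    same_off [:: vk; vt; vu; vh] [:: q] s' s2.
  by apply: same_off_sub => i; rewrite !inE ?orbb => //; do 6![case: eqP => //=].
apply: run_weaken; first apply: run_seq.
- apply: run_weaken (run_comb_init xs ys q8 en nX) (leqnn _) _ => s1 F1 R1.
  apply: run_wp_seq; rewrite /=; split=> //; try lia.
  pose I t s' := forall t' k, t' <= t -> k < n ->
    arr s' q (t' * n + k) = thr xs ys t' k.
  set s1' := set_var _ _ _.
  have S1' : same_off [:: vk; vt; vu; vh] [:: q] s s1'.
    apply: same_off_trans (S1 _ F1) _; split=> // i /=.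
    by rewrite !inE !negb_or => /and4P[_ /negPf-> _ _].
  apply: (@run_for_const _ _ _ s1' 0 T (70 * n + 8) I) => //.
  + by move=> s' /S2/(same_off_trans S1')/HT.
  + by move=> [|] // k _; rewrite mul0n /= add0n; apply: R1.
  move=> t s' tT et F Ir.
  have S3 := same_off_trans S1' (S2 _ _ F).
  have en' : var s' vn = n by rewrite S3.1.
  apply: run_weaken
    (run_comb_row (xs := xs) (ys := ys) q8 en' et _ _ szxy Ir) (leqnn _) _ => //.
    by apply: leq_trans TX; rewrite leq_mul2r ltnS (andP tT).2 orbT.
  move=> s2 F2 kn.
  have et2 : var s2 vt = t by rewrite F2.1.
  rewrite -et2; apply: Hxy kn; last by rewrite et2 (andP tT).2.
  exact: same_off_trans S3 (same_off_sub sub3 _ F2).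
- have : T * (70 * n + 8 + (size (exp_code eT tmp) + 4)) <= T * (70 * n + 30).
    by rewrite leq_mul2l; lia.
  by rewrite subn0 /=; lia.
by move=> s' _ [_ Ir].
Qed.

Lemma run_invert q et qg xs ys n t s :
  q < 8 -> qg < 8 -> q != qg -> var s vn = n -> n <= X -> t.+1 * n <= X ->
  t <= X ->
  (forall s', same_off [:: vk; vh] [:: qg] s s' -> safe s' et /\ eval s' et = t) ->
  (forall k, k < n -> arr s q (t * n + k) = thr xs ys t k) ->
  (forall j k1 k2, k1 < n -> k2 < n ->
     thr xs ys t k1 = j.+1 -> thr xs ys t k2 = j.+1 -> k1 = k2) ->
  size (exp_code et tmp) <= 10 ->
  run (invert q et qg) s (80 * n + 20)
    (fun s' => inverse_thr xs ys n t (arr s' qg)).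
Proof.
move=> q8 qg8 qqg en nX tX tX' Het row inj sz.
pose I1 k s' := forall j, j < k -> arr s' qg j = n.
pose I2 k s' := forall j, j < n ->
  (exists2 i, i < k & thr xs ys t i = j.+1 /\ arr s' qg j = i) \/
  (arr s' qg j = n /\ forall i, i < k -> thr xs ys t i <> j.+1).
apply: run_weaken; first apply: run_seq.
- have R1 : run (vk ::= #0 ;; For vk $vn (Put qg $vk $vn)) s (15 * n + 10) (I1 n).
    apply: run_weaken; first apply: run_wp_seq.
    + rewrite /=; split=> //; try lia.
      apply: (@run_for_const _ _ _ _ 0 n 6 I1) => //=; first by lia.
        by move=> s' [Fv _]; rewrite Fv.
      move=> k s' kn ek [Fv Fa] Ik; apply: run_wp => //=.
      have en' : var s' vn = n by rewrite Fv.
      rewrite ek en'; split=> //; first by lia.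
      move=> j; rewrite ltnS leq_eqVlt => /orP[jk|jk] /=; rewrite eqxx /= ?jk //.
      by rewrite Ik ?if_same.
    + by rewrite /=; lia.
    by move=> s' _ [].
  apply: run_weaken R1 (leqnn _) _ => s1 F1 R1.
  have S1 : same_off [:: vk; vh] [:: qg] s s1.
    by apply: same_off_sub F1 => i; rewrite !inE ?orbb => // ->.
  apply: run_wp_seq; rewrite /=; split=> //; try lia.
  set s1' := set_var _ _ _.
  have S1' : same_off [:: vk; vh] [:: qg] s s1'.
    apply: same_off_trans S1 _; split=> // i /=.
    by rewrite !inE !negb_or => /andP[/negPf-> _].
  apply: (@run_for_const _ _ _ s1' 0 n 45 I2) => //=; first by lia.
  + by move=> s' [Fv _]; rewrite Fv // S1'.1.
  + by move=> j jn; right; split=> //; apply: R1.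
  move=> k s' kn ek F Ik.
  have S' : same_off [:: vk; vh] [:: qg] s s'.
    apply: same_off_trans S1' (same_off_sub _ _ F) => i; rewrite !inE //.
  have [st vt'] := Het _ S'.
  have en' : var s' vn = n by rewrite S'.1.
  have eq' : arr s' q = arr s q by rewrite S'.2 // inE.
  apply: run_wp; last by rewrite /= !size_cat /=; lia.
  have i1 : t * n + k < X by apply: leq_trans tX; apply: idx_lt.
  have [ht _] := thr_vthr_le xs ys t k.
  have post0 s2 : thr xs ys t k = 0 -> arr s2 qg = arr s' qg -> I2 k.+1 s2.
    move=> e0 ea j jn; rewrite ea; case: (Ik j jn) => [[i ik H]|[e H]].
      by left; exists i => //; rewrite leqW.
    right; split=> // i; rewrite ltnS leq_eqVlt => /orP[/eqP->|/H//].
    by rewrite e0.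
  have postS s2 : 0 < thr xs ys t k ->
      arr s2 qg = upd (arr s' qg) (thr xs ys t k).-1 k -> I2 k.+1 s2.
    move=> e0 ea j jn; rewrite ea /=; case: eqP => [->|ne].
      by left; exists k; rewrite ?prednK.
    case: (Ik j jn) => [[i ik H]|[e H]].
      by left; exists i => //; rewrite leqW.
    right; split=> // i; rewrite ltnS leq_eqVlt => /orP[/eqP->|/H//].
    by move=> ek'; apply: ne; rewrite ek'.
  clearbody I2; rewrite /= vt' en' ek eq' row //.
  split=> //; [by do ![split=> //; try lia] | by lia | split=> //; try lia].
  case: posnP => h0; first exact: post0.
  split=> //; [by split=> //; lia | by lia |].
  by apply: postS => //=; rewrite eqxx subn1.
- by rewrite /=; lia.
move=> s' _ [_ H] j jn; case: (H j jn) => [[i iN [e1 e2]]|[e1 e2]].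
  by left; exists i.
by right.
Qed.

(** * One row of windows at a fixed cut *)

Section Scan.

Variables (v w : seq nat) (B r d : nat).
Local Notation m := (size v).
Local Notation n := (size w).
Hypotheses (B_gt0 : 0 < B) (Br : B <= r <= m) (Bn : B <= n) (mn : m <= n).
Hypothesis BX : B.+1 * n <= X.
Hypothesis dT : d <= depth v B r.

Local Notation thrA := (thr (xsA v r) (ysA w)).
Local Notation thrC := (thr (xsC v r) (ysC w)).
Local Notation cross := (cross v w B r d).
Local Notation opt := (opt v w B r d).
Local Notation scan_lo := (scan_lo v w B r d).
Local Notation scan_hi := (scan_hi v w B r d).

Let nX : n <= X. Proof. by apply: leq_trans BX; rewrite leq_pmull. Qed.
Let dB : d <= B. Proof. by apply: leq_trans dT _; rewrite /depth; lia. Qed.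

Definition scan_ctx (s : store) : Prop :=
  [/\ var s vn = n, var s vB = B, var s vd = d,
      (forall k, k < n -> arr s 0 ((B - d) * n + k) = thrA (B - d) k) /\
      (forall k, k < n -> arr s 1 (d * n + k) = thrC d k) &
      inverse_thr (xsA v r) (ysA w) n (B - d) (arr s 2) /\
      inverse_thr (xsC v r) (ysC w) n d (arr s 3)].

Lemma scan_ctx_same_off vs qs s s' :
  ~~ has (mem [:: vn; vB; vd]) vs -> ~~ has (mem [:: 0; 1; 2; 3]) qs ->
  same_off vs qs s s' -> scan_ctx s -> scan_ctx s'.
Proof.
move=> hv hq [Fv Fa] [en eB ed ra ia].
have Ev i : i \in [:: vn; vB; vd] -> var s' i = var s i.
  by move=> hi; apply: Fv; apply: contra hv => h; apply/hasP; exists i.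
have Ea q : q \in [:: 0; 1; 2; 3] -> arr s' q = arr s q.
  by move=> hi; apply: Fa; apply: contra hq => h; apply/hasP; exists q.
by rewrite /scan_ctx !Ev // !Ea.
Qed.

Lemma run_move_k j k s : scan_ctx s -> var s vj = j -> var s vk = k ->
  j <= k < j + B -> j + B <= n -> var s vval = cross j k ->
  run move_k s 40 (fun s' => var s' vval = cross j k.+1).
Proof.
move=> [en eB ed _ [iA iC]] ej ek jk jB ev.
have E := cross_k Br Bn dT iA iC jk jB.
have c1 := @cross_le v w B r Br Bn d j k _ jB.
have c2 := @cross_le v w B r Br Bn d j k.+1 _ jB.
have {}c1 : cross j k <= B by apply: c1; lia.
have {}c2 : cross j k.+1 <= B by apply: c2; lia.
apply: run_wp => //; rewrite /= ?addn1 en eB ej ek ev.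
split=> //; [by do ![split=> //; try lia] | by do ![split=> //; try lia] |].
by case: (ltnP (arr s 2 _)) E => h2; case: (ltnP (arr s 3 k)) => h3 E;
  do ![split=> //; try lia].
Qed.

Lemma run_scan j lo hi s : scan_ctx s -> var s vj = j -> j + B <= n ->
  j <= lo <= hi -> hi <= j + B -> arr s 4 j = hi -> var s vk = lo ->
  var s vval = cross j lo -> var s vbest = cross j lo -> var s vbk = lo ->
  run (For vk (Get 4 $vj) scan_step) s ((hi - lo) * 80 + 10) (fun s' =>
    var s' vbk = argmax (cross j) lo (hi - lo) /\
    var s' vbest = cross j (argmax (cross j) lo (hi - lo))).
Proof.
move=> cs ej jB lohi hiB e4 ek ev eb ebk.
pose I k s' := [/\ var s' vval = cross j k,
  var s' vbk = argmax (cross j) lo (k - lo) &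
  var s' vbest = cross j (argmax (cross j) lo (k - lo))].
apply: run_weaken.
- apply: (@run_for_const _ _ _ s lo hi 70 I) => //; try lia.
  + move=> s' F; have [Fv Fa] := F; rewrite /= Fv // Fa // ej e4.
    by do ![split=> //; try lia].
  + by rewrite /I subnn.
  move=> k s' /andP[lok khi] ek' F [eval' ebk' ebest'].
  have cs' : scan_ctx s' by apply: scan_ctx_same_off F cs.
  have ej' : var s' vj = j by rewrite F.1.
  apply: run_le; first apply: run_seq.
  + apply: run_weaken (run_move_k cs' ej' ek' _ jB eval') (leqnn _) _; first by lia.
    move=> s2 F2 e2.
    have ek2 : var s2 vk = k by rewrite F2.1.
    have eb2 : var s2 vbk = argmax (cross j) lo (k - lo) by rewrite F2.1.
    have ebest2 : var s2 vbest = cross j (argmax (cross j) lo (k - lo)).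
      by rewrite F2.1.
    have c2 : cross j k.+1 <= B by apply: cross_le => //; lia.
    apply: run_wp; last exact: leqnn.
    rewrite /= /I /= ?addn1 subSn //= addnS subnKC; last by lia.
    rewrite ebest2 ek2 e2 eb2.
    by case: ifP => h; do ![split=> //; try lia]; rewrite h.
  by [].
- by rewrite /=; lia.
by move=> s' _ [_ []].
Qed.

Lemma run_move_j j k s : scan_ctx s -> var s vj = j -> j + B < n ->
  j <= k <= j + B -> var s vk = k -> var s vval = cross j k ->
  run move_j s 150 (fun s' =>
    var s' vk = maxn j.+1 k /\ var s' vval = cross j.+1 (maxn j.+1 k)).
Proof.
move=> cs ej jB jk ek ev.
apply: run_le; first apply: run_seq.
- have [en _ _ _ _] := cs.
  have R1 : run (IfLt $vj $vk Skip (move_k ;; incr vk)) s 60 (fun s' =>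
      var s' vk = maxn j.+1 k /\ var s' vval = cross j (maxn j.+1 k)).
    have [jltk|kj] := ltnP j k.
      apply: run_le; first apply: (@run_ifLt _ _ _ _ _ _ _ _ _ 0) => //=.
      + move=> _; exists 0, s; split=> //; first exact: ExecSkip.
        have -> : maxn j.+1 k = k by lia.
        exact: conj ek ev.
      + by rewrite ej ek leqNgt jltk.
      by [].
    have ekj : k = j by lia.
    apply: run_le; first apply: (@run_ifLt _ _ _ _ _ _ _ _ _ 50) => //=.
    + by rewrite ej ek ltnNge kj.
    + move=> _; apply: run_le; first apply: run_seq.
      * apply: run_weaken (run_move_k cs ej ek _ (ltnW jB) ev) (leqnn _) _.
          by lia.
        move=> s2 F2 e2; have ek2 : var s2 vk = k by rewrite F2.1.
        apply: run_wp; last exact: leqnn.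
        rewrite /= ek2 ekj addn1 e2 ekj.
        have -> : maxn j.+1 j = j.+1 by lia.
        by do ![split=> //; try lia].
      by [].
    by [].
  apply: run_weaken R1 (leqnn _) _ => s2 F2 [ek2 ev2].
  have cs2 : scan_ctx s2 by apply: scan_ctx_same_off F2 cs.
  have ej2 : var s2 vj = j by rewrite F2.1.
  have [en2 eB2 ed2 [rA rC] _] := cs2.
  move: ek2 ev2; set k2 := maxn j.+1 k => ek2 ev2.
  have E := @cross_j v w B r Br Bn d j k2 dT _ jB.
  have {}E : _ := E ltac:(lia).
  have c1 : cross j k2 <= B by apply: cross_le => //; lia.
  have c2 : cross j.+1 k2 <= B by apply: cross_le => //; lia.
  apply: run_wp; last exact: leqnn.
  have i1 : (B - d) * n + (n - j.+1) < X.
    by apply: leq_trans BX; apply: idx_lt; lia.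
  have i2 : d * n + (j + B) < X by apply: leq_trans BX; apply: idx_lt; lia.
  rewrite /= ?addn1 ek2 ev2 ej2 en2 eB2 ed2 rA ?rC; try lia.
  by case: (ltnP k2 _) E => h1; case: (ltnP (n - k2) _) => h2 E;
    do ![split=> //; try lia].
by [].
Qed.

Lemma run_scan_end j a s : scan_ctx s -> var s vj = j -> j + B <= n ->
  var s vbk = opt j -> var s vbest = cross j (opt j) -> var s vans = a ->
  run scan_end s 250 (fun s' =>
    [/\ var s' vans = maxn a (cross j (opt j)), arr s' 4 = upd (arr s 4) j (opt j) &
        j + B < n -> var s' vk = scan_lo j.+1 /\
                     var s' vval = cross j.+1 (scan_lo j.+1)]).
Proof.
move=> cs ej jB ebk ebest ea.
have ob := opt_bounds v w B r d j.
have cB : cross j (opt j) <= B by apply: cross_le.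
have [en eB _ _ _] := cs.
apply: run_le; first apply: run_wp_seq; rewrite /=.
- have X0 : j < X by lia.
  rewrite ej ebk ebest ea; split=> //.
  set s1 := set_arr s 4 j (opt j).
  have R s2 : same_off [:: vans; vk; vval] [::] s1 s2 ->
      var s2 vans = maxn a (cross j (opt j)) -> var s2 vk = opt j ->
      var s2 vval = cross j (opt j) ->
      run (IfLt $vj ($vn [-] $vB) move_j Skip) s2 200 (fun s' =>
        [/\ var s' vans = maxn a (cross j (opt j)),
            arr s' 4 = upd (arr s 4) j (opt j) &
            j + B < n -> var s' vk = scan_lo j.+1 /\
                     var s' vval = cross j.+1 (scan_lo j.+1)]).
    move=> S2 ea2 ek2 ev2.
    have cs1 : scan_ctx s1.
      apply: (@scan_ctx_same_off [::] [:: 4] s s1) => //.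
      by split=> // q; rewrite inE /= => /negPf->.
    have cs2 : scan_ctx s2 by apply: scan_ctx_same_off S2 cs1.
    have [en2 eB2 _ _ _] := cs2.
    have ej2 : var s2 vj = j by rewrite S2.1.
    have e42 : arr s2 4 = upd (arr s 4) j (opt j) by rewrite S2.2.
    apply: run_le; first apply: (@run_ifLt _ _ _ _ _ _ _ _ _ 180).
    + by [].
    + by rewrite /= en2 eB2; do ![split=> //; try lia].
    + rewrite /= ej2 en2 eB2 => jn; have jBn : j + B < n by lia.
      apply: run_weaken (run_move_j cs2 ej2 jBn ob ek2 ev2) _ _ => //.
      by move=> s3 F3 [ek3 ev3]; split=> [||_]; [rewrite F3.1|rewrite F3.2|].
    + rewrite /= ej2 en2 eB2 => nj; exists 0, s2; split=> //.
        exact: ExecSkip.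
      by split=> //; lia.
    by [].
  have oW : opt j < W by lia.
  have cW : cross j (opt j) < W by lia.
  have S3 x y z s0 : same_off [:: vans; vk; vval] [::] s0
      (set_var (set_var (set_var s0 vans x) vk y) vval z).
    by split=> // i; rewrite !inE !negb_or => /and3P[/negPf h1 /negPf h2 /negPf h3] /=;
      rewrite h1 h2 h3.
  have S2 y z s0 : same_off [:: vans; vk; vval] [::] s0
      (set_var (set_var s0 vk y) vval z).
    by split=> // i; rewrite !inE !negb_or => /and3P[/negPf h1 /negPf h2 /negPf h3] /=;
      rewrite h2 h3.
  split=> //; case: ifP => h.
    by split=> //; split=> //; split=> //; apply: R; rewrite ?S3 //=; lia.
  by split=> //; split=> //; apply: R; rewrite ?S2 //= ea; lia.
by [].
Qed.

Lemma run_scan_column j a s : scan_ctx s -> var s vj = j -> j + B <= n ->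
  var s vk = scan_lo j -> var s vval = cross j (scan_lo j) ->
  arr s 4 j = scan_hi j -> var s vans = a ->
  run scan_column s ((scan_hi j - scan_lo j) * 80 + 300) (fun s' =>
    [/\ var s' vans = maxn a (cross j (opt j)), arr s' 4 = upd (arr s 4) j (opt j) &
        j + B < n -> var s' vk = scan_lo j.+1 /\
                     var s' vval = cross j.+1 (scan_lo j.+1)]).
Proof.
move=> cs ej jB ek ev e4 ea.
have [h1 h2] := scan_bounds Br Bn dT jB.
have cB : cross j (scan_lo j) <= B by apply: cross_le => //; lia.
apply: run_le; first apply: run_wp_seq; rewrite /=.
- rewrite ek ev; split=> //; first by lia.
  split=> //; first by lia.
  set s1 := set_var _ _ _.
  have S1 : same_off [:: vbest; vbk] [::] s s1.
    by split=> // i; rewrite !inE !negb_or => /andP[/negPf h3 /negPf h4] /=;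
      rewrite h3 h4.
  have cs1 : scan_ctx s1 by apply: scan_ctx_same_off S1 cs.
  apply: run_seq.
  apply: run_weaken (@run_scan j (scan_lo j) (scan_hi j) s1 _ _ _ _ _ _ _ _ _ _)
    (leqnn _) _ => //; try lia.
  move=> s2 F2; rewrite (scan_argmax Br Bn dT jB) => -[ebk2 ebest2].
  have cs2 : scan_ctx s2 by apply: scan_ctx_same_off F2 cs1.
  have ea2 : var s2 vans = a by rewrite F2.1.
  have ej2 : var s2 vj = j by rewrite F2.1.
  have e42 : arr s2 4 = arr s 4 by rewrite F2.2.
  have R := run_scan_end cs2 ej2 jB ebk2 ebest2 ea2; rewrite e42 in R; exact: R.
by lia.
Qed.

Lemma run_scan_init s : var s vn = n -> var s vB = B -> var s vd = d ->
  (forall k, k < n -> arr s 1 (d * n + k) = thrC d k) ->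
  run scan_init s (50 * n + 20) (fun s' => var s' vval = cross 0 0).
Proof.
move=> en eB ed row.
pose I k s' := var s' vval = grid v w r d 0 k.
apply: run_weaken; first apply: run_wp_seq; rewrite /=.
- do 2![split=> //; try lia].
  apply: (@run_for_const _ _ _ _ 0 B 30 I) => //=; first by lia.
  + by move=> s' [Fv _]; rewrite Fv.
  + by rewrite /I /= /grid /seg subnn take0 lcs0r.
  move=> k s' kB ek F Ik; rewrite /I in Ik.
  have en' : var s' vn = n by rewrite F.1.
  have ed' : var s' vd = d by rewrite F.1.
  have row' : arr s' 1 = arr s 1 by rewrite F.2.
  have i1 : d * n + k < X by apply: leq_trans BX; apply: idx_lt; lia.
  have g1 : grid v w r d 0 k <= k - 0 by apply: grid_le; lia.
  apply: run_wp => //=; rewrite en' ed' ek row' row; last by lia.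
  rewrite /I /= (gridC_thr Br Bn dT) ?leq0n; last by lia.
  split=> //; [by lia | by do ![split=> //; try lia] |].
  case: (posnP (thrC d k)) => h; first by rewrite h /= Ik; do ![split=> //; try lia].
  by rewrite leqNgt h Ik addn0.
- by rewrite /=; lia.
move=> s' _ [_ ->]; rewrite /cross.
by rewrite grid_refl.
Qed.

Lemma run_scan_columns a s : scan_ctx s ->
  (forall j, j + B <= n -> arr s 4 j = scan_hi j) ->
  var s vans = a -> var s vval = cross 0 0 ->
  run scan_columns s
    (\sum_(0 <= j < (n - B).+1) (scan_hi j - scan_lo j) * 80 + 320 * n + 20)
    (fun s' =>
       var s' vans = maxn a (\max_(0 <= j < (n - B).+1) cross j (opt j)) /\
       forall j, j + B <= n -> arr s' 4 j = opt j).
Proof.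
move=> cs e4 ea ev.
(* Array 4 is updated in place: left of j it holds the optima of this row, from j on still the upper
   ends inherited from the row before. *)
pose I j s' := [/\ var s' vans = maxn a (\max_(0 <= j' < j) cross j' (opt j')),
  forall j', j' + B <= n -> arr s' 4 j' = if j' < j then opt j' else scan_hi j' &
  j + B <= n -> var s' vk = scan_lo j /\ var s' vval = cross j (scan_lo j)].
apply: run_weaken; first apply: run_wp_seq; rewrite /=.
- do 2![split=> //; try lia].
  set s1 := set_var _ _ _.
  have S1 : same_off [:: vk; vj] [::] s s1.
    by split=> // i; rewrite !inE !negb_or => /andP[/negPf h1 /negPf h2] /=;
      rewrite h1 h2.
  have cs1 : scan_ctx s1 by apply: scan_ctx_same_off S1 cs.
  apply: (@run_for _ _ _ _ vj _ _ s1 0 (n - B).+1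
    (fun j => (scan_hi j - scan_lo j) * 80 + 300) I) => //; first by lia.
  + move=> s' F; have [en' eB' _ _ _] : scan_ctx s' by apply: scan_ctx_same_off F cs1.
    by rewrite /= en' eB'; do ![split=> //; try lia].
  + split; first by rewrite big_geq // maxn0.
      by move=> j' /e4.
    by [].
  move=> j s' jn ej F [Ia I4 Ik].
  have cs' : scan_ctx s' by apply: scan_ctx_same_off F cs1.
  have jB : j + B <= n by lia.
  have [ek' ev'] := Ik jB.
  have e4' : arr s' 4 j = scan_hi j by rewrite I4 // ltnn.
  apply: run_weaken (run_scan_column cs' ej jB ek' ev' e4' Ia) (leqnn _) _.
  move=> s2 F2 [ea2 e42 ekv]; split=> //=.
  + by rewrite big_nat_recr //= maxnA.
  + move=> j' jB'; rewrite e42 /= ltnS leq_eqVlt; case: eqP => [->//|_] /=.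
    exact: I4.
- rewrite /= big_split /= big_split /= !sum_nat_const_nat.
  by lia.
move=> s' _ [_ [ea' e4' _]]; split=> // j jB.
by rewrite e4' // ifT //; lia.
Qed.

Lemma run_row a s : var s vn = n -> var s vB = B -> var s vd = d ->
  (forall k, k < n -> arr s 0 ((B - d) * n + k) = thrA (B - d) k) ->
  (forall k, k < n -> arr s 1 (d * n + k) = thrC d k) ->
  (forall j, j + B <= n -> arr s 4 j = scan_hi j) ->
  var s vans = a ->
  run row s (\sum_(0 <= j < (n - B).+1) (scan_hi j - scan_lo j) * 80 + 700 * n)
    (fun s' =>
       var s' vans = maxn a (\max_(0 <= j < (n - B).+1) cross j (opt j)) /\
       forall j, j + B <= n -> arr s' 4 j = opt j).
Proof.
move=> en eB ed row0 row1 e4 ea.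
have n0 : 0 < n by lia.
have BdX : (B - d).+1 * n <= X.
  by apply: leq_trans BX; rewrite leq_mul2r ltnS leq_subr orbT.
have dX : d.+1 * n <= X.
  by apply: leq_trans BX; rewrite leq_mul2r ltnS dB orbT.
have BX' : B <= X by lia.
apply: run_le; first apply: run_seq.
- apply: run_weaken
    (@run_invert 0 ($vB [-] $vd) 2 (xsA v r) (ysA w) n (B - d) s _ _ _ _ _ _ _ _ _ _ _)
    (leqnn _) _ => //; first by lia.
  + move=> s' F; rewrite /= !F.1 // eB ed.
    by do ![split=> //; try lia].
  + by move=> j k1 k2; apply: (thrA_inj Br); rewrite // leq_subr.
  move=> s1 F1 iA.
  have en1 : var s1 vn = n by rewrite F1.1.
  have ed1 : var s1 vd = d by rewrite F1.1.
  apply: run_seq; apply: run_weaken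
    (@run_invert 1 $vd 3 (xsC v r) (ysC w) n d s1 _ _ _ _ _ _ _ _ _ _ _)
    (leqnn _) _ => //; first by lia.
  + by move=> s' F; rewrite /= !F.1.
  + by rewrite F1.2.
  + by move=> j k1 k2; apply: (thrC_inj Br).
  move=> s2 F2 iC.
  have en2 : var s2 vn = n by rewrite F2.1.
  have eB2 : var s2 vB = B by rewrite F2.1 // F1.1.
  have ed2 : var s2 vd = d by rewrite F2.1.
  have cs2 : scan_ctx s2.
    by split=> //; split=> //; rewrite F2.2 // ?F1.2.
  have row12 : forall k, k < n -> arr s2 1 (d * n + k) = thrC d k.
    by rewrite F2.2 // F1.2.
  apply: run_seq; apply: run_weaken (run_scan_init en2 eB2 ed2 row12) (leqnn _) _.
  move=> s3 F3 ev3; apply: run_scan_columns => //.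
  + by apply: scan_ctx_same_off F3 cs2.
  + by rewrite F3.2 // F2.2 // F1.2.
  by rewrite F3.1 // F2.1 // F1.1.
by lia.
Qed.

End Scan.

(** * All windows at one cut, and the loop over the cuts *)

Section Strips.

Variables (v w : seq nat) (B : nat).
Local Notation m := (size v).
Local Notation n := (size w).
Hypotheses (B_gt0 : 0 < B) (Bm : B <= m) (mn : m <= n).
Hypothesis BX : B.+1 * n <= X.
Hypotheses (M_eq : M = m + n) (inpE : forall x, inp x = nth 0 (v ++ w) x).

Let nX : n <= X. Proof. by apply: leq_trans BX; rewrite leq_pmull. Qed.
Let Bn : B <= n. Proof. exact: leq_trans Bm mn. Qed.

Section Strip.

Variable r : nat.
Hypothesis Br : B <= r <= m.

Definition strip_ctx (s : store) : Prop :=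
  [/\ var s vm = m, var s vn = n, var s vB = B, var s vr = r &
      var s vT = depth v B r].

Lemma strip_ctx_same_off vs qs s s' :
  ~~ has (mem [:: vm; vn; vB; vr; vT]) vs ->
  same_off vs qs s s' -> strip_ctx s -> strip_ctx s'.
Proof.
move=> hv [Fv _] [em en eB er eT].
have Ev i : i \in [:: vm; vn; vB; vr; vT] -> var s' i = var s i.
  by move=> hi; apply: Fv; apply: contra hv => h; apply/hasP; exists i.
by rewrite /strip_ctx !Ev.
Qed.

Lemma run_comb_above s : strip_ctx s ->
  run comb_above s (B * (70 * n + 30) + 20 * n + 20) (fun s' =>
    forall t k, t <= B -> k < n ->
      arr s' 0 (t * n + k) = thr (xsA v r) (ysA w) t k).
Proof.
move=> cs; have [em en eB er eT] := cs.
apply: run_comb => //; first by lia.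
  by move=> s' /strip_ctx_same_off/(_ cs) => -[] // em' en' eB' er' eT'.
move=> s' /strip_ctx_same_off/(_ cs) => -[] // em' en' eB' er' eT' tB kn.
rewrite /= em' en' er' !inpE !nth_cat /xsA /ysA !nth_rev; try lia.
rewrite ifT; last by lia.
rewrite ifF; last by lia.
split; try (by do ![split=> //; try lia]); congr nth; lia.
Qed.

Lemma run_comb_below s : strip_ctx s ->
  run comb_below s (B * (70 * n + 30) + 20 * n + 20) (fun s' =>
    forall t k, t <= depth v B r -> k < n ->
      arr s' 1 (t * n + k) = thr (xsC v r) (ysC w) t k).
Proof.
move=> cs; have [em en eB er eT] := cs.
have dB : depth v B r <= B by rewrite /depth; lia.
have dm : r + depth v B r <= m by rewrite /depth; lia.
apply: (@run_le _ _ (depth v B r * (70 * n + 30) + 20 * n + 20)); last first.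
  by rewrite !leq_add2r leq_mul2r dB orbT.
apply: run_comb => //; try lia.
- by apply: leq_trans BX; rewrite leq_mul2r ltnS dB orbT.
- by move=> s' /strip_ctx_same_off/(_ cs) => -[] // em' en' eB' er' eT'.
move=> s' /strip_ctx_same_off/(_ cs) => -[] // em' en' eB' er' eT' tB kn.
rewrite /= em' er' !inpE !nth_cat /xsC /ysC.
rewrite ifT; last by lia.
rewrite ifF; last by lia.
by split; try (by do ![split=> //; try lia]); rewrite // addKn.
Qed.

Lemma run_reset_bounds s : strip_ctx s ->
  run reset_bounds s (50 * n + 20) (fun s' =>
    forall j, j + B <= n -> arr s' 4 j = j + B).
Proof.
move=> cs.
pose I j s' := forall j', j' < j -> arr s' 4 j' = j' + B.
apply: run_weaken; first apply: run_wp_seq; rewrite /=.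
- split=> //; try lia.
  set s1 := set_var _ _ _.
  have cs1 : strip_ctx s1.
    apply: (@strip_ctx_same_off [:: vj] [::] s) => //.
    by split=> // i; rewrite inE /= => /negPf->.
  apply: (@run_for_const vj _ _ s1 0 (n - B).+1 30 I) => //; first by lia.
  + move=> s' F; have [_ en' eB' _ _] : strip_ctx s' by apply: strip_ctx_same_off F cs1.
    by rewrite /= en' eB'; do ![split=> //; try lia].
  move=> j s' jn ej F Ij.
  have [_ en' eB' _ _] : strip_ctx s' by apply: strip_ctx_same_off F cs1.
  apply: run_wp => //=; rewrite ej eB'; split=> //; try by do ![split=> //; try lia].
    by lia.
  move=> j'; rewrite ltnS leq_eqVlt => /orP[/eqP->|jj] /=; first by rewrite eqxx.
  by rewrite ifF ?Ij //; lia.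
- by rewrite /=; lia.
by move=> s' _ [_ H] j jB; apply: H; lia.
Qed.

Lemma run_rows c s : strip_ctx s ->
  (forall t k, t <= B -> k < n ->
     arr s 0 (t * n + k) = thr (xsA v r) (ysA w) t k) ->
  (forall t k, t <= depth v B r -> k < n ->
     arr s 1 (t * n + k) = thr (xsC v r) (ysC w) t k) ->
  (forall j, j + B <= n -> arr s 4 j = j + B) ->
  var s vans = c ->
  run rows s (2000 * (n * B)) (fun s' =>
    var s' vans = maxn c (\max_(0 <= d < (depth v B r).+1)
      \max_(0 <= j < (n - B).+1) window_lcs v w B (r - B + d) j)).
Proof.
move=> cs rows0 rows1 e4 ec.
have dB : depth v B r <= B by rewrite /depth; lia.
have dm : r + depth v B r <= m by rewrite /depth; lia.
pose I d s' :=
  var s' vans = maxn c (\max_(0 <= d' < d)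
    \max_(0 <= j < (n - B).+1) window_lcs v w B (r - B + d') j) /\
  forall j, j + B <= n -> arr s' 4 j = scan_hi v w B r d j.
pose C d := \sum_(0 <= j < (n - B).+1) (scan_hi v w B r d j - scan_lo v w B r d j).
apply: run_weaken; first apply: run_wp_seq; rewrite /=.
- split=> //; try lia.
  set s1 := set_var _ _ _.
  have S1 : same_off [:: vd] [::] s s1.
    by split=> // i; rewrite inE /= => /negPf->.
  have cs1 : strip_ctx s1 by apply: strip_ctx_same_off S1 cs.
  apply: (@run_for _ _ _ _ vd _ _ s1 0 (depth v B r).+1
    (fun d => C d * 80 + 700 * n) I) => //; first by lia.
  + move=> s' F; have [_ _ _ _ eT'] : strip_ctx s' by apply: strip_ctx_same_off F cs1.
    by rewrite /= eT'; do ![split=> //; try lia].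
  + split; first by rewrite big_geq // maxn0.
    exact: e4.
  move=> d s' /andP[_ dT] ed F [Ic I4]; rewrite ltnS in dT.
  have [_ en' eB' _ _] : strip_ctx s' by apply: strip_ctx_same_off F cs1.
  rewrite /C big_distrl /=.
  apply: run_weaken (@run_row v w B r d B_gt0 Br Bn mn BX dT _ s'
    en' eB' ed _ _ I4 Ic) (leqnn _) _.
  + by move=> k kn; rewrite F.2 // rows0 // leq_subr.
  + by move=> k kn; rewrite F.2 // rows1.
  move=> s2 F2 [ec2 e42]; split=> //=.
  rewrite ec2 [\max_(0 <= d' < d.+1) _]big_nat_recr //= maxnA; congr maxn.
  by apply: eq_big_nat => j jn; rewrite cross_opt //; lia.
(* The scans take (n - B + 1) * B + (depth + 1) * n moves in all; everything else is O(n) for each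
   of the at most B + 1 rows. *)
- have CT := @scan_total v w B r Br Bn (depth v B r).+1 (leqnn _).
  rewrite /= big_split /= big_split /= !sum_nat_const_nat -big_distrl /=.
  have nP : n <= n * B by rewrite leq_pmulr.
  have BP : B <= n * B by rewrite leq_pmull //; lia.
  have h1 : (n - B).+1 * B <= n * B by rewrite leq_mul2r; lia.
  have h2 : (depth v B r).+1 * n <= n + n * B.
    by rewrite mulSn leq_add2l mulnC leq_mul2l dB orbT.
  move: CT; rewrite -/(C _) -[X in X <= _]/(\sum_(0 <= d < (depth v B r).+1) C d).
  by move: (\sum_(0 <= d < _) C d) => S; lia.
by move=> s' _ [_ []].
Qed.

End Strip.

Lemma run_strip a c s : a < m %/ B ->
  var s vm = m -> var s vn = n -> var s vB = B -> var s va = a -> var s vans = c ->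
  run strip s (3000 * (n * B)) (fun s' =>
    var s' vans = maxn c (\max_(0 <= d < (depth v B (a.+1 * B)).+1)
      \max_(0 <= j < (n - B).+1) window_lcs v w B (a * B + d) j)).
Proof.
move=> am em en eB ea ec.
have Br : B <= a.+1 * B <= m.
  by rewrite leq_pmull //= (leq_trans _ (leq_trunc_div m B)) // leq_mul2r am orbT.
have -> : a * B = a.+1 * B - B by rewrite mulSn addKn.
move: Br; set r := a.+1 * B => Br.
apply: run_le; first apply: run_seq.
- have R1 : run strip_bounds s 30 (strip_ctx r).
    have aB : a.+1 * B = r by [].
    apply: run_wp => //=; rewrite em eB ea addn1 aB.
    have am' : a < m by apply: leq_trans am (leq_div _ _).
    split=> //; [by do ![split=> //; try lia] | by lia |].
    split=> //; [by do ![split=> //; try lia] | by lia |].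
    split=> //; case: ltnP => h; do ?[split=> //=; try (rewrite /depth; lia)].
  apply: run_weaken R1 (leqnn _) _ => s1 F1 cs1.
  have ec1 : var s1 vans = c by rewrite F1.1.
  apply: run_seq; apply: run_weaken (run_comb_above Br cs1) (leqnn _) _ => s2 F2 r2.
  have cs2 : strip_ctx r s2 by apply: strip_ctx_same_off F2 cs1.
  apply: run_seq; apply: run_weaken (run_comb_below Br cs2) (leqnn _) _ => s3 F3 r3.
  have cs3 : strip_ctx r s3 by apply: strip_ctx_same_off F3 cs2.
  apply: run_seq; apply: run_weaken (run_reset_bounds Br cs3) (leqnn _) _ => s4 F4 e4.
  have cs4 : strip_ctx r s4 by apply: strip_ctx_same_off F4 cs3.
  apply: run_rows => //.
  + by rewrite F4.2 // F3.2.
  + by rewrite F4.2.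
  by rewrite F4.1 // F3.1 // F2.1.
have nP : n <= n * B by rewrite leq_pmulr.
have BP : B <= n * B by rewrite leq_pmull //; lia.
by lia.
Qed.

Lemma run_main s : var s vm = m -> var s vn = n -> var s vB = B ->
  run main s (4000 * (m * n)) (fun s' => var s' vm = best_window v w B).
Proof.
move=> em en eB.
have mX : m <= X by lia.
have qm : m %/ B * B <= m by apply: leq_trunc_div.
have q_le : m %/ B <= m by apply: leq_div.
pose I a s' := var s' vans = \max_(0 <= a' < a)
  \max_(0 <= d < (depth v B (a'.+1 * B)).+1)
    \max_(0 <= j < (n - B).+1) window_lcs v w B (a' * B + d) j.
apply: run_le.
  apply: (@run_ifLt _ _ _ _ _ _ _ _ _
    (10 + (m %/ B * (3000 * (n * B) + 10) + 10))) => //=; rewrite em eB => hB.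
    by lia.
  apply: run_le; first apply: run_wp_seq; rewrite /=.
    do 2![split=> //; try lia].
    set s1 := set_var _ _ _.
    apply: run_seq; apply: run_weaken.
    - apply: (@run_for_const va _ _ s1 0 (m %/ B) (3000 * (n * B)) I) => //; first by lia.
      + move=> s' F; rewrite /= !F.1 //= em eB.
        by do ![split=> //; try lia].
      + by rewrite /I big_geq.
      move=> a s' /andP[_ am] ea F Ia.
      apply: run_weaken (run_strip am _ _ _ ea Ia) (leqnn _) _; try by rewrite F.1.
      by move=> s2 F2 e2; rewrite /I /= e2 [RHS]big_nat_recr.
    - exact: leqnn.
    move=> s2 F2 [_ e2]; apply: run_wp; last exact: leqnn.
    rewrite /= e2; split=> //.
    by apply: (leq_ltn_trans (best_window_le v w B)); lia.
  by rewrite /=; lia.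
rewrite /=.
(* The strips cost O(n * B) each and number m %/ B, where (m %/ B) * B <= m. *)
have h1 : m %/ B * (3000 * (n * B) + 10) <= 3000 * (m * n) + 10 * m.
  have : m %/ B * B * n <= m * n by rewrite leq_mul2r qm orbT.
  by lia.
have mP : m <= m * n by rewrite leq_pmulr //; lia.
by lia.
Qed.

End Strips.

End Verification.

(** * The compiled program on the machine input *)

Definition lcs_br_program : program := compile main.

Lemma lcs_br_programP B v w : 0 < size v -> size v <= size w -> 0 < B <= size w ->
  exists t, [/\ t <= 4001 * (size v * size w),
    halted lcs_br_program (lcs_br_run lcs_br_program 6 B v w t) &
    forall k, is_lcs_br B v w k ->
      output (lcs_br_run lcs_br_program 6 B v w t) = k].
Proof.
move=> m0 mn /andP[B0 Bn].
set m := size v in m0 mn *; set n := size w in mn Bn *.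
(* When B <= m, a threshold array has at most m + 1 rows of n cells. The factor 6 gives W >= (m + n
   + 1)^6, enough for all addresses. *)
pose b := word_size 6 (m + n); pose X := m.+1 * n.
have X_lt : m + n + 8 * X + 8 < 2 ^ b.
  have hM : m + n < 2 ^ (trunc_log 2 (m + n)).+1 by apply: trunc_log_ltn.
  rewrite /b /word_size [6 * _]mulnC expnM.
  apply: (@leq_trans ((m + n).+1 ^ 6)); last by rewrite leq_exp2r.
  have -> : (m + n).+1 ^ 6 = ((m + n).+1 * (m + n).+1) ^ 2 * ((m + n).+1 * (m + n).+1).
    by rewrite mulnn -!expnM -expnD.
  have M3 : 3 <= (m + n).+1 by lia.
  have hX : X <= (m + n).+1 * (m + n).+1 by apply: leq_mul; lia.
  have hM2 : (m + n).+1 <= (m + n).+1 * (m + n).+1 by rewrite leq_pmulr.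
  have h9 : 9 <= (m + n).+1 * (m + n).+1 by apply: (@leq_mul 3 3).
  (* With Y = (m + n + 1)^2 >= 9 the sixth power is Y^3 >= 81 * Y, while the left-hand side is at
     most 9 * Y + 8. *)
  move: ((m + n).+1 * (m + n).+1) hX hM2 h9 => Y hX hM2 h9.
  have : 81 * Y <= Y ^ 2 * Y by rewrite leq_mul2r (@leq_exp2r 9 _ 2) // h9 orbT.
  by lia.
have mn0 : 0 < m * n by rewrite muln_gt0; lia.
pose s0 := Store (nth 0 [:: m; n; B])
  (fun q x => nth 0 (v ++ w) (m + n + (8 * x + q))).
have [t [s' [E ht post]]] : run b (m + n) X (nth 0 (v ++ w)) main s0
    (4000 * (m * n)) (fun s' => forall k, is_lcs_br B v w k -> var s' 0 = k).
  (* If |v| < B, then [v] has no factor of length B: not even the empty word is a common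
     B-subsequence, no k meets the specification, and halting is enough. *)
  have [mB|Bm] := ltnP m B.
    apply: run_le; first apply: (@run_ifLt _ _ _ _ _ _ _ _ _ 0) => //=.
    - move=> _; exists 0, s0; split=> //; first exact: ExecSkip.
      by move=> k [[s [[i]]]]; lia.
    - by lia.
    by have -> : size (test_code $vm $vB) = 0 by []; lia.
  have BX : B.+1 * n <= X by rewrite leq_mul2r ltnS Bm orbT.
  apply: run_weaken (@run_main b (m + n) X (nth 0 (v ++ w)) X_lt v w B B0 Bm mn BX
    erefl (fun=> erefl) s0 erefl erefl erefl) (leqnn _) _.
  by move=> s2 _ -> k; apply: best_windowP.
have [|//|//|r [h [Erun er]]] :=
  @compile_run b (m + n) X (nth 0 (v ++ w)) X_lt main t s0 s' (nth 0 (v ++ w)) E.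
  by [].
(* The extra instruction is the one prefixed by [compile]; as m * n >= 1, it turns 4000 into
   4001. *)
exists t.+1; rewrite /lcs_br_run /lcs_br_input.
rewrite (Erun : iter t.+1 (step b lcs_br_program) _ = _).
split; [by lia | exact: compile_halted |].
by move=> k /post <-; rewrite /output /= er.
Qed.

Import Order.TTheory GRing.Theory Num.Theory.
Import numFieldNormedType.Exports.

Local Open Scope classical_set_scope.

Theorem theorem5 (R : realType) :
  exists (p : program) (c : nat) (C : R) (eps : nat -> R),
    [/\ (0 < c)%N,
        eps n @[n --> \oo] --> (0%R : R) &
        forall (sigma B : nat) (v w : seq nat),
          (0 < sigma)%N ->
          all (fun a => (1 <= a <= sigma)%N) v ->
          all (fun a => (1 <= a <= sigma)%N) w ->
          (size v <= size w)%N ->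
          (sigma <= size v)%N ->
          (1 <= B <= size w)%N ->
          let N := (size v * size w)%N in
          exists t : nat,
            [/\ (t%:R <= C * N%:R * (B%:R `^ eps B))%R,
                halted p (lcs_br_run p c B v w t) &
                forall k : nat,
                  is_lcs_br B v w k -> output (lcs_br_run p c B v w t) = k]].
Proof.
exists lcs_br_program, 6, 4001%:R%R, (fun=> 0%R); split=> //; first exact: cvg_cst.
move=> sigma B v w sigma_gt0 _ _ mn sigma_le hB N.
(* From 1 <= sigma <= |v| the product m * n is positive, so the constant overhead is absorbed. *)
have m_gt0 : (0 < size v)%N by exact: leq_trans sigma_le.
have [t [ht hh ho]] := lcs_br_programP m_gt0 mn hB.
exists t; split=> //.
by rewrite powRr0 mulr1 -natrM ler_nat.
Qed.
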